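(* Let $\omega\in\mathcal{W}_0$ be given with $\gamma(\omega)>1$. Then for any $\gamma>0$ satisfying $0<\gamma<\gamma(\omega)-1$ and for all $l>0$ there exist $d''\in\mathbb{N}_{>0}$ and a continuous linear extension operator $$E^{\omega}_{\gamma,l}:\Lambda^1_{\omega,l}\longrightarrow\mathcal{A}_{\omega,d''l}(S_{\gamma}),$$ i.e. $\mathcal{B}(E^{\omega}_{\gamma,l}(\lambda))=\lambda$ holds for every sequence $\lambda\in\Lambda^1_{\omega,l}$. Consequently the Borel map $\mathcal{B}:\mathcal{A}_{\{\omega\}}(S_{\gamma})\longrightarrow\Lambda^1_{\{\omega\}}$ is surjective for any $0<\gamma<\gamma(\omega)-1$.
   Context: $\mathbb{N}=\{0,1,2,\dots\}$, $\mathbb{N}_{>0}=\{1,2,\dots\}$. A weight function is a continuous nondecreasing function $\omega:[0,+\infty)\to[0,+\infty)$ with $\omega(0)=0$ and $\lim_{t\to+\infty}\omega(t)=+\infty$. $\mathcal{W}_0$ is the set of weight functions $\omega$ such that: $\omega(t)=0$ for all $t\in[0,1]$; $\log(t)=o(\omega(t))$ as $t\to+\infty$; and $\varphi_\omega:t\mapsto\omega(e^t)$ is convex on $\mathbb{R}$. For $\omega\in\mathcal{W}_0$ put $\varphi^{*}_{\omega}(x):=\sup\{xy-\varphi_{\omega}(y):y\ge 0\}$, $x\ge 0$. Growth index: $\gamma(\omega):=\sup\{\gamma>0:\ \exists K>1:\ \limsup_{t\to+\infty}\frac{\omega(K^{\gamma}t)}{\omega(t)}<K\}\in[0,+\infty]$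 (equal to $0$ if the set is empty). Sectors: $\mathcal{R}$ is the Riemann surface of the logarithm and, for $\gamma>0$, $S_\gamma:=\{z\in\mathcal{R}:|\arg(z)|<\gamma\pi/2\}$. $\mathcal{H}(S)$ is the space of holomorphic functions on $S$. Spaces: for $l>0$, $\mathcal{A}_{\omega,l}(S):=\{f\in\mathcal{H}(S):\|f\|_{\omega,l}:=\sup_{z\in S,p\in\mathbb{N}}\frac{|f^{(p)}(z)|}{\exp(\frac1l\varphi^{*}_{\omega}(lp))}<+\infty\}$, $\mathcal{A}_{\{\omega\}}(S):=\bigcup_{l>0}\mathcal{A}_{\omega,l}(S)$; and $\Lambda^1_{\omega,l}:=\{a=(a_p)_p\in\mathbb{C}^{\mathbb{N}}:|a|_{\omega,l}:=\sup_{p\in\mathbb{N}}\frac{|a_p|}{\exp(\frac1l\varphi^{*}_{\omega}(lp))}<+\infty\}$, $\Lambda^1_{\{\omega\}}:=\bigcup_{l>0}\Lambda^1_{\omega,l}$. $\mathcal{A}_{\omega,l}(S)$ and $\Lambda^1_{\omega,l}$ carry the Banach space norms just given. Borel map: $\mathcal{B}(f):=(f^{(p)}(0))_{p\in\mathbb{N}}$, where $f^{(p)}(0):=\lim_{z\in S,\,z\to 0}f^{(p)}(z)$. *)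

(* Defs.v *)
From Stdlib Require Import Reals.
From Coquelicot Require Import Coquelicot.

Open Scope R_scope.

(** * Weight functions *)

(* A function on [0, +oo) is represented by a function on R of which only
   the values at nonnegative arguments are used. *)
Definition weight_function (omega : R -> R) : Prop :=
  continuous_on (fun t => 0 <= t) omega /\
  (forall t, 0 <= t -> 0 <= omega t) /\
  (forall s t, 0 <= s -> s <= t -> omega s <= omega t) /\
  omega 0 = 0 /\
  is_lim omega p_infty p_infty.

Definition convex_fun (f : R -> R) : Prop :=
  forall x y s, 0 <= s <= 1 ->
    f (s * x + (1 - s) * y) <= s * f x + (1 - s) * f y.

Definition phi (omega : R -> R) (t : R) : R := omega (exp t).

(* [is_domin F f g] is Coquelicot's g = o(f) along the filter F. *)
Definition W0 (omega : R -> R) : Prop :=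
  weight_function omega /\
  (forall t, 0 <= t <= 1 -> omega t = 0) /\
  is_domin (Ku := R_AbsRing) (Kv := R_AbsRing)
    (U := R_NormedModule) (V := R_NormedModule)
    (Rbar_locally p_infty) omega ln /\
  convex_fun (phi omega).

(* The supremum is finite for omega in W0, because log t = o(omega(t));
   it is then its own real part. *)
Definition phi_star (omega : R -> R) (x : R) : R :=
  real (Lub_Rbar (fun v => exists y, 0 <= y /\ v = x * y - phi omega y)).

Definition limsup_infty (f : R -> R) : Rbar :=
  Rbar_glb (fun m => exists T : R,
    m = Lub_Rbar (fun v => exists t, T <= t /\ v = f t)).

(* The element 0 gives the convention that the index is 0 when no g > 0
   qualifies, and does not change the supremum otherwise. *)
Definition growth_index (omega : R -> R) : Rbar :=
  Lub_Rbar (fun g => g = 0 \/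
    (0 < g /\ exists K, 1 < K /\
       Rbar_lt (limsup_infty (fun t => omega (Rpower K g * t) / omega t)) K)).

(** * The Riemann surface of the logarithm *)

(* The pair (x, theta) is the point of modulus e^x and argument theta; the
   global chart log makes the surface homeomorphic to R x R. *)
Definition RLog : UniformSpace :=
  prod_UniformSpace R_UniformSpace R_UniformSpace.

Definition rl_mod (z : RLog) : R := exp (fst z).
Definition rl_arg (z : RLog) : R := snd z.

(* The covering projection onto C \ {0}. *)
Definition rl_proj (z : RLog) : C :=
  (rl_mod z * cos (rl_arg z), rl_mod z * sin (rl_arg z)).

Definition sector (gamma : R) (z : RLog) : Prop :=
  Rabs (rl_arg z) < gamma * PI / 2.

(* Complex derivative with respect to the variable z itself (that is, to
   [rl_proj z]), not to the chart coordinate log z. *)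
Definition is_rl_derive (f : RLog -> C) (z : RLog) (d : C) : Prop :=
  filterlim (fun w => ((f w - f z) / (rl_proj w - rl_proj z))%C)
    (locally' z) (locally d).

(* Holomorphic functions on an open set S are represented by functions on the
   whole surface, of which only the values on S matter. *)
Definition holomorphic_on (S : RLog -> Prop) (f : RLog -> C) : Prop :=
  forall z, S z -> exists d, is_rl_derive f z d.

Definition rl_derive (f : RLog -> C) (z : RLog) : C :=
  iota (T := C_R_CompleteNormedModule) (is_rl_derive f z).

Fixpoint rl_derive_n (f : RLog -> C) (p : nat) : RLog -> C :=
  match p with
  | O => f
  | S q => rl_derive (rl_derive_n f q)
  end.

(* The filter z -> 0, z in S; the point 0 is not on the surface. *)
Definition to_zero (S : RLog -> Prop) : (RLog -> Prop) -> Prop :=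
  within S (fun P => exists delta : posreal, forall z, rl_mod z < delta -> P z).

(** * Weighted spaces and the Borel map *)

Definition weight (omega : R -> R) (l : R) (p : nat) : R :=
  exp (1 / l * phi_star omega (l * INR p)).

Definition A_norm (omega : R -> R) (l : R) (S : RLog -> Prop)
    (f : RLog -> C) : Rbar :=
  Lub_Rbar (fun v => exists z p,
    S z /\ v = Cmod (rl_derive_n f p z) / weight omega l p).

Definition in_A (omega : R -> R) (l : R) (S : RLog -> Prop)
    (f : RLog -> C) : Prop :=
  holomorphic_on S f /\ Rbar_lt (A_norm omega l S f) p_infty.

Definition in_A_union (omega : R -> R) (S : RLog -> Prop)
    (f : RLog -> C) : Prop :=
  exists l, 0 < l /\ in_A omega l S f.

Definition Lambda_norm (omega : R -> R) (l : R) (a : nat -> C) : Rbar :=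
  Lub_Rbar (fun v => exists p, v = Cmod (a p) / weight omega l p).

Definition in_Lambda (omega : R -> R) (l : R) (a : nat -> C) : Prop :=
  Rbar_lt (Lambda_norm omega l a) p_infty.

Definition in_Lambda_union (omega : R -> R) (a : nat -> C) : Prop :=
  exists l, 0 < l /\ in_Lambda omega l a.

(* B(f) = a, including the existence of all the limits f^(p)(0). *)
Definition is_borel (S : RLog -> Prop) (f : RLog -> C) (a : nat -> C) : Prop :=
  forall p, filterlim (rl_derive_n f p) (to_zero S) (locally (a p)).

(** * Operators from Lambda^1_{omega,l} to A_{omega,m}(S) *)

Definition maps_into (omega : R -> R) (l m : R) (S : RLog -> Prop)
    (E : (nat -> C) -> RLog -> C) : Prop :=
  forall a, in_Lambda omega l a -> in_A omega m S (E a).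

(* Equality in A_{omega,m}(S) is equality on S. *)
Definition linear_operator (omega : R -> R) (l : R) (S : RLog -> Prop)
    (E : (nat -> C) -> RLog -> C) : Prop :=
  (forall a b, in_Lambda omega l a -> in_Lambda omega l b ->
     forall z, S z -> E (fun p => (a p + b p)%C) z = (E a z + E b z)%C) /\
  (forall (c : C) a, in_Lambda omega l a ->
     forall z, S z -> E (fun p => (c * a p)%C) z = (c * E a z)%C).

Definition continuous_operator (omega : R -> R) (l m : R) (S : RLog -> Prop)
    (E : (nat -> C) -> RLog -> C) : Prop :=
  forall a, in_Lambda omega l a -> forall eps : posreal,
  exists delta : posreal, forall b, in_Lambda omega l b ->
    Rbar_lt (Lambda_norm omega l (fun p => (b p - a p)%C)) delta ->
    Rbar_lt (A_norm omega m S (fun z => (E b z - E a z)%C)) eps.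

Definition extension_operator (omega : R -> R) (l : R) (S : RLog -> Prop)
    (E : (nat -> C) -> RLog -> C) : Prop :=
  forall a, in_Lambda omega l a -> is_borel S (E a) a.

(* Main.v *)
Require Import Defs.
From Stdlib Require Import Reals Lra Lia Factorial List Classical IndefiniteDescription.
From Coquelicot Require Import Coquelicot.

(* The extension of a sequence (c_p) is f(z) = sum_p (c_p / p!) T_p(z) with
     T_p(z) = z^p (1 - e^(-v) sum_(k<N) v^k / k!),  v = m (r / z)^a,
   where gamma < 1 / a < gamma(omega) - 1 and N is about m / a. The
   cutoff, an incomplete Gamma function, is close to 1 up to e^(-c m (r/|z|)^a)
   near 0 and of size (r / |z|)^m at infinity. If Q nearly maximises
   Q^p e^(-omega(Q) / l), that is, nearly attains the weight of index p, the
   right choice is m = p + 1 + eta omega(Q) / l and r = eta m / Q with eta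
   small. The term T_p for p >= k, and T_p - z^p for p < k, is then bounded by
   2^(-p) |z|^k / k! times
     D^k s^k Q^k e^(-omega(Q) / (2l)),  s = max(1, k / m)^(1 + 1/a),
   and this is at most a constant times the weight of index k for a parameter
   d l, because omega(s Q) <= M (k / m) (omega(Q) + 1) = O(k l + omega(Q)).
   Cauchy's estimates on a slightly larger sector, written in the coordinate
   w = log z in which everything is entire, turn these bounds for k = n into
   the bound for the n-th derivative, and for k = n + 1 into its limit at 0. *)

Open Scope R_scope.

(** * Complex derivatives *)

(** The gap of 1 between [gamma] and the growth index comes from two opposite demands on [a]. Both
    cutoff estimates need Re z^(-a) to be at least a fixed fraction of |z|^(-a) on a strip slightly
    wider than the sector, which forces gamma < 1/a. For p < k two powers of k/m are lost: k!/p!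
    against m^(k-p) costs (k/m)^(k-p), and maximising (r/|z|)^(k-p) against the exponential decay of
    the cutoff costs (k/m)^((k-p)/a). Together they are at most s^k, and omega, growing no faster
    than t^(1/g), absorbs s^k when 1 + 1/a <= g. The order m must exceed p, for the decay at
    infinity, and dominate omega(Q), so that omega(Q)/m stays bounded. The constant eta reconciles
    both: being small, it lets e^(lambda m) consume only half of e^(-omega(Q)/l); entering r, it
    supplies eta^(p-k), which pays for the part of e^(lambda m) growing with p and leaves 2^(-p).
    The parameters depend on omega, gamma, l and p, never on the sequence, so the extension is
    linear; the factor 2^(-p) makes every series converge normally, with a bound proportional to the
    norm of the sequence. *)

Definition cexp (z : C) : C :=
  (exp (fst z) * cos (snd z), exp (fst z) * sin (snd z)).

(** The increment form has no quotient, so h = 0 is allowed and compositions need no case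
    distinction. *)
Definition is_cderive (f : C -> C) (z d : C) : Prop :=
  forall eps, 0 < eps -> exists delta, 0 < delta /\
    forall h, Cmod h < delta ->
      Cmod (f (z + h) - f z - d * h)%C <= eps * Cmod h.

Lemma Rabs_fst_le_Cmod (z : C) : Rabs (fst z) <= Cmod z.
Proof. eapply Rle_trans; [apply Rmax_l | apply Rmax_Cmod]. Qed.

Lemma Rabs_snd_le_Cmod (z : C) : Rabs (snd z) <= Cmod z.
Proof. eapply Rle_trans; [apply Rmax_r | apply Rmax_Cmod]. Qed.

Lemma Cmod_le_Rabs (z : C) : Cmod z <= Rabs (fst z) + Rabs (snd z).
Proof.
  replace z with (RtoC (fst z) + (0, snd z))%C at 1.
  - eapply Rle_trans; [apply Cmod_triangle|].
    apply Rplus_le_compat.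
    + rewrite Cmod_R; lra.
    + unfold Cmod; simpl. apply Req_le.
      rewrite <- sqrt_Rsqr_abs. f_equal. unfold Rsqr; ring.
  - destruct z; unfold RtoC, Cplus; simpl; f_equal; ring.
Qed.

Lemma cexp_plus (z w : C) : cexp (z + w) = (cexp z * cexp w)%C.
Proof.
  unfold cexp, Cplus, Cmult; simpl.
  rewrite exp_plus, cos_plus, sin_plus; f_equal; ring.
Qed.

Lemma cexp_0 : cexp 0 = 1%C.
Proof.
  unfold cexp, RtoC; simpl. rewrite exp_0, cos_0, sin_0; f_equal; ring.
Qed.

Lemma Cmod_cexp (z : C) : Cmod (cexp z) = exp (fst z).
Proof.
  unfold cexp, Cmod; simpl.
  replace (_ + _) with (Rsqr (exp (fst z))).
  - rewrite sqrt_Rsqr; [reflexivity | left; apply exp_pos].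
  - generalize (sin2_cos2 (snd z)); unfold Rsqr; intros H.
    transitivity (exp (fst z) * exp (fst z) *
      (sin (snd z) * sin (snd z) + cos (snd z) * cos (snd z))); [rewrite H|]; ring.
Qed.

Lemma is_cderive_ext (f g : C -> C) z d :
  (forall w, f w = g w) -> is_cderive f z d -> is_cderive g z d.
Proof.
  intros E H eps He; destruct (H eps He) as [de [Hd H']].
  exists de; split; auto. intros h Hh; rewrite <- !E; auto.
Qed.

Lemma is_cderive_const (c z : C) : is_cderive (fun _ => c) z 0.
Proof.
  intros eps He; exists 1; split; [lra|]; intros h _.
  replace (c - c - 0 * h)%C with (RtoC 0) by ring.
  rewrite Cmod_0. apply Rmult_le_pos; [lra | apply Cmod_ge_0].
Qed.

Lemma is_cderive_id (z : C) : is_cderive (fun w => w) z 1.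
Proof.
  intros eps He; exists 1; split; [lra|]; intros h _.
  replace (z + h - z - 1 * h)%C with (RtoC 0) by ring.
  rewrite Cmod_0. apply Rmult_le_pos; [lra | apply Cmod_ge_0].
Qed.

Lemma is_cderive_plus (f g : C -> C) z d e :
  is_cderive f z d -> is_cderive g z e ->
  is_cderive (fun w => f w + g w)%C z (d + e).
Proof.
  intros Hf Hg eps He.
  destruct (Hf (eps / 2)) as [d1 [Hd1 H1]]; [lra|].
  destruct (Hg (eps / 2)) as [d2 [Hd2 H2]]; [lra|].
  exists (Rmin d1 d2); split; [apply Rmin_pos; auto|]; intros h Hh.
  specialize (H1 h (Rlt_le_trans _ _ _ Hh (Rmin_l _ _))).
  specialize (H2 h (Rlt_le_trans _ _ _ Hh (Rmin_r _ _))).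
  replace (f (z + h) + g (z + h) - (f z + g z) - (d + e) * h)%C with
    ((f (z + h) - f z - d * h) + (g (z + h) - g z - e * h))%C by ring.
  eapply Rle_trans; [apply Cmod_triangle|]. lra.
Qed.

Lemma is_cderive_bounded_increment (f : C -> C) z d :
  is_cderive f z d -> exists delta, 0 < delta /\
    forall h, Cmod h < delta -> Cmod (f (z + h) - f z)%C <= (Cmod d + 1) * Cmod h.
Proof.
  intros H; destruct (H 1) as [de [Hd H']]; [lra|].
  exists de; split; auto; intros h Hh; specialize (H' h Hh).
  replace (f (z + h) - f z)%C with ((f (z + h) - f z - d * h) + d * h)%C by ring.
  eapply Rle_trans; [apply Cmod_triangle|]. rewrite Cmod_mult. lra.
Qed.

Lemma is_cderive_comp (f g : C -> C) z d e :
  is_cderive f (g z) d -> is_cderive g z e ->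
  is_cderive (fun w => f (g w)) z (d * e).
Proof.
  intros Hf Hg eps He.
  pose proof (Cmod_ge_0 d) as Pd. pose proof (Cmod_ge_0 e) as Pe.
  destruct (Hf (eps / 2 / (Cmod e + 1))) as [d1 [Hd1 H1]].
  { repeat apply Rdiv_lt_0_compat; lra. }
  destruct (Hg (eps / 2 / (Cmod d + 1))) as [d2 [Hd2 H2]].
  { repeat apply Rdiv_lt_0_compat; lra. }
  destruct (is_cderive_bounded_increment g z e Hg) as [d3 [Hd3 H3]].
  assert (P : 0 < d1 / (Cmod e + 1)) by (apply Rdiv_lt_0_compat; lra).
  exists (Rmin (d1 / (Cmod e + 1)) (Rmin d2 d3)).
  split; [repeat apply Rmin_pos; auto|]; intros h Hh.
  pose proof (Rmin_l (d1 / (Cmod e + 1)) (Rmin d2 d3)).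
  pose proof (Rmin_r (d1 / (Cmod e + 1)) (Rmin d2 d3)).
  pose proof (Rmin_l d2 d3). pose proof (Rmin_r d2 d3).
  pose proof (Cmod_ge_0 h) as Ph.
  set (k := (g (z + h) - g z)%C).
  assert (Hk : Cmod k <= (Cmod e + 1) * Cmod h) by (apply H3; lra).
  assert (Hk1 : Cmod k < d1).
  { eapply Rle_lt_trans; [apply Hk|].
    apply Rmult_lt_reg_r with (/ (Cmod e + 1)); [apply Rinv_0_lt_compat; lra|].
    replace ((Cmod e + 1) * Cmod h * / (Cmod e + 1)) with (Cmod h) by (field; lra).
    unfold Rdiv in *; lra. }
  specialize (H1 k Hk1). specialize (H2 h ltac:(lra)).
  replace (g z + k)%C with (g (z + h)%C) in H1 by (unfold k; ring).
  replace (f (g (z + h)) - f (g z) - d * e * h)%C with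
   ((f (g (z + h)) - f (g z) - d * k) + d * (g (z + h) - g z - e * h))%C
    by (unfold k; ring).
  eapply Rle_trans; [apply Cmod_triangle|]. rewrite Cmod_mult.
  replace (eps * Cmod h) with (eps / 2 / (Cmod e + 1) * ((Cmod e + 1) * Cmod h)
     + (Cmod d + 1) * (eps / 2 / (Cmod d + 1) * Cmod h)) by (field; lra).
  apply Rplus_le_compat.
  - eapply Rle_trans; [apply H1|]. apply Rmult_le_compat_l; [|exact Hk].
    left; repeat apply Rdiv_lt_0_compat; lra.
  - apply Rmult_le_compat; try apply Cmod_ge_0; lra.
Qed.

Lemma is_cderive_sqr (z : C) : is_cderive (fun w => w * w)%C z (2 * z).
Proof.
  intros eps He; exists eps; split; auto; intros h Hh.
  replace ((z + h) * (z + h) - z * z - 2 * z * h)%C with (h * h)%C by ring.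
  rewrite Cmod_mult. apply Rmult_le_compat_r; [apply Cmod_ge_0 | lra].
Qed.

Lemma is_cderive_scal (c : C) (f : C -> C) z d :
  is_cderive f z d -> is_cderive (fun w => c * f w)%C z (c * d).
Proof.
  intros H eps He. pose proof (Cmod_ge_0 c) as Pc.
  destruct (H (eps / (Cmod c + 1))) as [de [Hd H']].
  { apply Rdiv_lt_0_compat; lra. }
  exists de; split; auto; intros h Hh; specialize (H' h Hh).
  replace (c * f (z + h) - c * f z - c * d * h)%C
    with (c * (f (z + h) - f z - d * h))%C by ring.
  rewrite Cmod_mult.
  replace (eps * Cmod h) with ((Cmod c + 1) * (eps / (Cmod c + 1) * Cmod h))
    by (field; lra).
  apply Rmult_le_compat; try apply Cmod_ge_0; lra.
Qed.

Lemma is_cderive_mult (f g : C -> C) z d e :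
  is_cderive f z d -> is_cderive g z e ->
  is_cderive (fun w => f w * g w)%C z (d * g z + f z * e).
Proof.
  intros Hf Hg.
  (* polarisation reduces the product rule to the chain rule for squares *)
  assert (HP : (RtoC 2 <> 0)%C) by (intros E; apply RtoC_inj in E; lra).
  assert (H : is_cderive (fun w => / 2 * ((f w + g w) * (f w + g w)
     + (-1) * (f w * f w + g w * g w)))%C z
     (/ 2 * (2 * (f z + g z) * (d + e)
     + (-1) * (2 * f z * d + 2 * g z * e)))%C).
  { apply is_cderive_scal, is_cderive_plus; [|apply is_cderive_scal, is_cderive_plus].
    - apply (is_cderive_comp (fun w => w * w)%C); [apply is_cderive_sqr|].
      apply is_cderive_plus; auto.
    - apply (is_cderive_comp (fun w => w * w)%C); [apply is_cderive_sqr|auto].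
    - apply (is_cderive_comp (fun w => w * w)%C); [apply is_cderive_sqr|auto]. }
  replace (d * g z + f z * e)%C with (/ 2 * (2 * (f z + g z) * (d + e)
     + (-1) * (2 * f z * d + 2 * g z * e)))%C by (field; auto).
  eapply is_cderive_ext; [|exact H]. intros w; simpl; field; auto.
Qed.

(** Since e^(z+h) - e^z - e^z h = e^z (e^h - 1 - h), only the behaviour at 0 matters, and there the
    real derivatives of exp, cos and sin suffice. *)
Lemma is_cderive_cexp (z : C) : is_cderive cexp z (cexp z).
Proof.
  intros eps He. set (M := Cmod (cexp z)).
  assert (PM : 0 < M) by (unfold M; rewrite Cmod_cexp; apply exp_pos).
  (* With [e <= 1] the crude bounds |e^x - 1| <= 2|x| and |sin y| <= 2|y| hold; the real and
     imaginary parts then cost 3 e |h| each, within the 8 e |h| available. *)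
  set (e := Rmin 1 (eps / M / 8)).
  assert (Pe : 0 < e).
  { apply Rmin_pos; [lra|]. repeat apply Rdiv_lt_0_compat; lra. }
  pose proof (Rmin_l 1 (eps / M / 8)) as L1. fold e in L1.
  pose proof (Rmin_r 1 (eps / M / 8)) as L2. fold e in L2.
  assert (Q : forall f l, derivable_pt_lim f 0 l -> exists d, 0 < d /\
     forall h, Rabs h < d -> Rabs (f h - f 0 - l * h) <= e * Rabs h).
  { intros f l H. destruct (H e Pe) as [[d Hd] H']; simpl in H'.
    exists d; split; auto; intros h Hh.
    destruct (Req_dec h 0) as [->|N].
    - replace (f 0 - f 0 - l * 0) with 0 by ring. rewrite Rabs_R0; lra.
    - specialize (H' h N Hh). rewrite Rplus_0_l in H'.
      replace (f h - f 0 - l * h) with (((f h - f 0) / h - l) * h) by (field; auto).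
      rewrite Rabs_mult. apply Rmult_le_compat_r; [apply Rabs_pos | lra]. }
  destruct (Q exp _ (derivable_pt_lim_exp 0)) as [d1 [P1 H1]].
  destruct (Q cos _ (derivable_pt_lim_cos 0)) as [d2 [P2 H2]].
  destruct (Q sin _ (derivable_pt_lim_sin 0)) as [d3 [P3 H3]].
  rewrite exp_0 in H1. rewrite sin_0, cos_0 in H2. rewrite sin_0, cos_0 in H3.
  set (D := Rmin (Rmin d1 d2) (Rmin d3 (e / 2))).
  assert (PD : 0 < D) by (repeat apply Rmin_pos; lra).
  assert (LD : D <= d1 /\ D <= d2 /\ D <= d3 /\ D <= e / 2).
  { unfold D. generalize (Rmin_l (Rmin d1 d2) (Rmin d3 (e / 2)))
      (Rmin_r (Rmin d1 d2) (Rmin d3 (e / 2))) (Rmin_l d1 d2) (Rmin_r d1 d2)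
      (Rmin_l d3 (e / 2)) (Rmin_r d3 (e / 2)). lra. }
  exists D; split; auto; intros h Hh.
  rewrite cexp_plus.
  replace (cexp z * cexp h - cexp z - cexp z * h)%C
     with (cexp z * (cexp h - 1 - h))%C by ring.
  rewrite Cmod_mult. fold M.
  apply Rle_trans with (M * (8 * e * Cmod h)).
  2:{ replace (eps * Cmod h) with (M * (8 * (eps / M / 8) * Cmod h)) by (field; lra).
      apply Rmult_le_compat_l; [lra|]. apply Rmult_le_compat_r; [apply Cmod_ge_0 | lra]. }
  apply Rmult_le_compat_l; [lra|].
  destruct h as [x y].
  pose proof (Rabs_fst_le_Cmod (x, y)) as Hx. pose proof (Rabs_snd_le_Cmod (x, y)) as Hy.
  simpl in Hx, Hy. set (m := Cmod (x, y)) in *.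
  specialize (H1 x ltac:(lra)). specialize (H2 y ltac:(lra)). specialize (H3 y ltac:(lra)).
  pose proof (Rabs_pos x) as Px. pose proof (Rabs_pos y) as Py.
  assert (B : Rabs (exp x - 1) <= 2 * Rabs x).
  { replace (exp x - 1) with ((exp x - 1 - 1 * x) + x) by ring.
    eapply Rle_trans; [apply Rabs_triang|]. nra. }
  assert (B' : Rabs (exp x) <= 2).
  { replace (exp x) with ((exp x - 1) + 1) by ring.
    eapply Rle_trans; [apply Rabs_triang|]. rewrite Rabs_R1. nra. }
  assert (S : Rabs (sin y) <= 2 * Rabs y).
  { replace (sin y) with ((sin y - 0 - 1 * y) + y) by ring.
    eapply Rle_trans; [apply Rabs_triang|]. nra. }
  eapply Rle_trans; [apply Cmod_le_Rabs|]. unfold cexp, Cminus, Cplus, Copp, RtoC; simpl.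
  assert (X : Rabs (exp x * cos y + - (1) + - x) <= 3 * e * m).
  { replace (exp x * cos y + - (1) + - x) with
      ((exp x - 1 - 1 * x) + exp x * (cos y - 1 - - 0 * y)) by ring.
    eapply Rle_trans; [apply Rabs_triang|]. rewrite Rabs_mult.
    assert (Rabs (exp x) * Rabs (cos y - 1 - - 0 * y) <= 2 * (e * m)).
    { apply Rmult_le_compat; try apply Rabs_pos; auto. nra. }
    nra. }
  assert (Y : Rabs (exp x * sin y + - 0 + - y) <= 3 * e * m).
  { replace (exp x * sin y + - 0 + - y) with
      ((exp x - 1) * sin y + (sin y - 0 - 1 * y)) by ring.
    eapply Rle_trans; [apply Rabs_triang|]. rewrite Rabs_mult.
    assert (Rabs (exp x - 1) * Rabs (sin y) <= (2 * m) * (2 * (e / 2))).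
    { apply Rmult_le_compat; try apply Rabs_pos; nra. }
    nra. }
  assert (0 <= m) by apply Cmod_ge_0. nra.
Qed.

(** The curve moves by h (x', y') + o(h), and [f] multiplies this by [d]. Means over circles and
    mean values along segments reduce to real calculus through this rule. *)
Lemma is_cderive_real_path (f : C -> C) (x y : R -> R) (t x' y' : R) (d : C) :
  is_derive x t x' -> is_derive y t y' -> is_cderive f (x t, y t) d ->
  is_derive (fun u => fst (f (x u, y u))) t (fst (d * (x', y'))%C) /\
  is_derive (fun u => snd (f (x u, y u))) t (snd (d * (x', y'))%C).
Proof.
  intros Hx Hy Hf.
  apply is_derive_Reals in Hx. apply is_derive_Reals in Hy.
  assert (Q : forall eps, 0 < eps -> exists delta, 0 < delta /\
    forall h, h <> 0 -> Rabs h < delta ->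
      Cmod (f (x (t + h)%R, y (t + h)%R) - f (x t, y t) - d * (x', y') * h)%C
        <= eps * Rabs h).
  { intros eps He.
    pose proof (Cmod_ge_0 d) as Pd.
    set (L := Rabs x' + Rabs y' + 2).
    assert (PL : 0 < L) by (unfold L; generalize (Rabs_pos x') (Rabs_pos y'); lra).
    destruct (Hf (eps / 2 / L)) as [d1 [P1 H1]].
    { repeat apply Rdiv_lt_0_compat; lra. }
    set (e := Rmin 1 (eps / 4 / (Cmod d + 1))).
    assert (Pe : 0 < e) by (apply Rmin_pos; [lra|]; repeat apply Rdiv_lt_0_compat; lra).
    assert (e1 : e <= 1) by apply Rmin_l.
    assert (e2 : e <= eps / 4 / (Cmod d + 1)) by apply Rmin_r.
    destruct (Hx e Pe) as [[d2 P2] H2]. destruct (Hy e Pe) as [[d3 P3] H3].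
    simpl in H2, H3.
    assert (P4 : 0 < d1 / L) by (apply Rdiv_lt_0_compat; lra).
    exists (Rmin (d1 / L) (Rmin d2 d3)); split; [repeat apply Rmin_pos; auto|].
    intros h N Hh.
    pose proof (Rmin_l (d1 / L) (Rmin d2 d3)).
    pose proof (Rmin_r (d1 / L) (Rmin d2 d3)).
    pose proof (Rmin_l d2 d3). pose proof (Rmin_r d2 d3).
    specialize (H2 h N ltac:(lra)). specialize (H3 h N ltac:(lra)).
    assert (Ph : 0 < Rabs h) by (apply Rabs_pos_lt; auto).
    set (k := (x (t + h) - x t, y (t + h) - y t) : C).
    assert (K1 : Cmod (k - (x', y') * h)%C <= 2 * e * Rabs h).
    { eapply Rle_trans; [apply Cmod_le_Rabs|].
      unfold k, Cminus, Cplus, Copp, Cmult, RtoC; simpl.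
      replace (x (t + h) - x t + - (x' * h - y' * 0)) with
         (((x (t + h) - x t) / h - x') * h) by (field; auto).
      replace (y (t + h) - y t + - (x' * 0 + y' * h)) with
         (((y (t + h) - y t) / h - y') * h) by (field; auto).
      rewrite !Rabs_mult. nra. }
    assert (K2 : Cmod k <= L * Rabs h).
    { replace k with ((k - (x', y') * h) + (x', y') * h)%C by ring.
      eapply Rle_trans; [apply Cmod_triangle|]. rewrite Cmod_mult, Cmod_R.
      pose proof (Cmod_le_Rabs (x', y')) as T; simpl in T. unfold L. nra. }
    assert (K3 : Cmod k < d1).
    { eapply Rle_lt_trans; [apply K2|].
      apply Rmult_lt_reg_r with (/ L); [apply Rinv_0_lt_compat; lra|].
      replace (L * Rabs h * / L) with (Rabs h) by (field; lra).
      unfold Rdiv in *; lra. }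
    specialize (H1 k K3).
    replace ((x t, y t) + k)%C with (x (t + h), y (t + h)) in H1
      by (unfold k, Cplus; simpl; f_equal; ring).
    replace (f (x (t + h)%R, y (t + h)%R) - f (x t, y t) - d * (x', y') * h)%C with
     ((f (x (t + h)%R, y (t + h)%R) - f (x t, y t) - d * k) + d * (k - (x', y') * h))%C
      by ring.
    eapply Rle_trans; [apply Cmod_triangle|]. rewrite Cmod_mult.
    replace (eps * Rabs h) with (eps / 2 / L * (L * Rabs h) +
      (Cmod d + 1) * (2 * (eps / 4 / (Cmod d + 1)) * Rabs h)) by (field; lra).
    apply Rplus_le_compat.
    - eapply Rle_trans; [apply H1|]. apply Rmult_le_compat_l; [|lra].
      left; repeat apply Rdiv_lt_0_compat; lra.
    - apply Rmult_le_compat; try apply Cmod_ge_0; [lra|].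
      eapply Rle_trans; [apply K1|]. nra. }
  split; apply is_derive_Reals; intros eps He;
    (destruct (Q (eps / 2)) as [de [Pd H]]; [lra|]);
    exists (mkposreal de Pd); simpl; intros h N Hh; specialize (H h N Hh);
    assert (Ph : 0 < Rabs h) by (apply Rabs_pos_lt; auto).
  - apply Rmult_lt_reg_r with (Rabs h); auto. rewrite <- Rabs_mult.
    apply Rle_lt_trans with (eps / 2 * Rabs h); [|nra].
    eapply Rle_trans; [|apply H]. eapply Rle_trans; [|apply Rabs_fst_le_Cmod].
    apply Req_le; f_equal.
    unfold Cminus, Cplus, Copp, Cmult, RtoC; simpl. field; auto.
  - apply Rmult_lt_reg_r with (Rabs h); auto. rewrite <- Rabs_mult.
    apply Rle_lt_trans with (eps / 2 * Rabs h); [|nra].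
    eapply Rle_trans; [|apply H]. eapply Rle_trans; [|apply Rabs_snd_le_Cmod].
    apply Req_le; f_equal.
    unfold Cminus, Cplus, Copp, Cmult, RtoC; simpl. field; auto.
Qed.

(** * Cauchy's estimate *)

Lemma is_cderive_continuous (g : C -> C) z d :
  is_cderive g z d -> forall eps, 0 < eps -> exists delta, 0 < delta /\
    forall w, Cmod (w - z)%C < delta -> Cmod (g w - g z)%C < eps.
Proof.
  intros H eps He.
  destruct (is_cderive_bounded_increment g z d H) as [de [Pd Hd]].
  pose proof (Cmod_ge_0 d).
  assert (P : 0 < eps / (Cmod d + 1)) by (apply Rdiv_lt_0_compat; lra).
  exists (Rmin de (eps / (Cmod d + 1))); split; [apply Rmin_pos; auto|].
  intros w Hw.
  specialize (Hd (w - z)%C (Rlt_le_trans _ _ _ Hw (Rmin_l _ _))).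
  replace (z + (w - z))%C with w in Hd by ring.
  eapply Rle_lt_trans; [apply Hd|].
  apply Rlt_le_trans with ((Cmod d + 1) * (eps / (Cmod d + 1))).
  - apply Rmult_lt_compat_l; [lra|]. eapply Rlt_le_trans; [apply Hw | apply Rmin_r].
  - apply Req_le; field; lra.
Qed.

Lemma continuity_2d_pt_cderive (g : C -> C) (x y : R -> R -> R) (r t : R) (d : C) :
  is_cderive g (x r t, y r t) d ->
  continuity_2d_pt x r t -> continuity_2d_pt y r t ->
  continuity_2d_pt (fun u v => fst (g (x u v, y u v))) r t /\
  continuity_2d_pt (fun u v => snd (g (x u v, y u v))) r t.
Proof.
  intros H Hx Hy.
  assert (Q : forall eps, 0 < eps -> exists delta : posreal, forall u v,
    Rabs (u - r) < delta -> Rabs (v - t) < delta ->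
    Cmod (g (x u v, y u v) - g (x r t, y r t))%C < eps).
  { intros eps He.
    destruct (is_cderive_continuous _ _ _ H eps He) as [de [Pd Hd]].
    assert (P2 : 0 < de / 2) by lra.
    destruct (Hx (mkposreal _ P2)) as [d1 H1]. destruct (Hy (mkposreal _ P2)) as [d2 H2].
    simpl in H1, H2.
    exists (mkposreal _ (Rmin_pos d1 d2 (cond_pos d1) (cond_pos d2))); simpl.
    intros u v Hu Hv. apply Hd.
    eapply Rle_lt_trans; [apply Cmod_le_Rabs|]; simpl.
    pose proof (Rmin_l d1 d2). pose proof (Rmin_r d1 d2).
    specialize (H1 u v ltac:(lra) ltac:(lra)). specialize (H2 u v ltac:(lra) ltac:(lra)).
    unfold Rminus in H1, H2. lra. }
  split; intros eps; destruct (Q eps (cond_pos eps)) as [de Hd]; exists de;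
    intros u v Hu Hv; specialize (Hd u v Hu Hv).
  - eapply Rle_lt_trans; [|apply Hd]. eapply Rle_trans; [|apply Rabs_fst_le_Cmod].
    apply Req_le; reflexivity.
  - eapply Rle_lt_trans; [|apply Hd]. eapply Rle_trans; [|apply Rabs_snd_le_Cmod].
    apply Req_le; reflexivity.
Qed.

Lemma is_derive_difference_quotient (A B : R -> R) (u0 v0 c s r a b : R) :
  0 < r -> is_derive A r a -> is_derive B r b ->
  is_derive (fun r => ((A r - u0) * c + (B r - v0) * s) / r) r
    ((a * c + b * s - ((A r - u0) * c + (B r - v0) * s) / r) / r).
Proof.
  intros Hr HA HB. auto_derive.
  - repeat split; try lra; [exists a | exists b]; assumption.
  - replace (Derive (fun x => A x) r) with a by (symmetry; apply is_derive_unique, HA).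
    replace (Derive (fun x => B x) r) with b by (symmetry; apply is_derive_unique, HB).
    field. lra.
Qed.

Lemma is_derive_rotation (A B : R -> R) (u0 v0 t a b : R) :
  is_derive A t a -> is_derive B t b ->
  is_derive (fun t => (B t - v0) * cos t - (A t - u0) * sin t) t
    (b * cos t - a * sin t - ((A t - u0) * cos t + (B t - v0) * sin t)).
Proof.
  intros HA HB. auto_derive.
  - repeat split; [exists b | exists a]; assumption.
  - replace (Derive (fun x => A x) t) with a by (symmetry; apply is_derive_unique, HA).
    replace (Derive (fun x => B x) t) with b by (symmetry; apply is_derive_unique, HB).
    ring.
Qed.

(* The mean over a circle of radius [r] of [Re ((g(w) - g(w0)) / (w - w0))] is
   independent of [r]; letting [r] tend to 0 gives Cauchy's formula for the
   real part of [g'(w0)]. *)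
Lemma cauchy_estimate_fst (g g1 g2 : C -> C) (w0 : C) (rho M : R) :
  (forall w, is_cderive g w (g1 w)) -> (forall w, is_cderive g1 w (g2 w)) ->
  0 < rho -> (forall h, Cmod h <= rho -> Cmod (g (w0 + h)%C) <= M) ->
  Rabs (fst (g1 w0)) <= 2 * M / rho.
Proof.
  intros Hg Hg1 Hrho HM. destruct w0 as [x0 y0].
  set (x := fun r t : R => x0 + r * cos t). set (y := fun r t : R => y0 + r * sin t).
  set (u0 := fst (g (x0, y0))). set (v0 := snd (g (x0, y0))).
  set (u := fun r t : R => fst (g (x r t, y r t))).
  set (v := fun r t : R => snd (g (x r t, y r t))).
  set (p := fun r t : R => fst (g1 (x r t, y r t))).
  set (q := fun r t : R => snd (g1 (x r t, y r t))).
  (* [P] is the real part of the difference quotient at w0, and [Q] is r times its imaginary part.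
     [DP] and [DQ] below yield the polar Cauchy-Riemann equation dP/dr = r^(-2) dQ/dt; as [Q] is 2
     pi-periodic in t, the derivative of [H] vanishes. *)
  set (P := fun r t : R => ((u r t - u0) * cos t + (v r t - v0) * sin t) / r).
  set (Q := fun r t : R => (v r t - v0) * cos t - (u r t - u0) * sin t).
  set (H := fun r : R => RInt (P r) 0 (2 * PI)).
  assert (DP : forall r t : R, 0 < r ->
     is_derive (fun r => P r t) r ((p r t - P r t) / r)).
  { intros r t Hr.
    destruct (is_cderive_real_path g (fun r => x r t) (fun r => y r t) r
       (cos t) (sin t) (g1 (x r t, y r t))) as [A B].
    - unfold x; auto_derive; [trivial | ring].
    - unfold y; auto_derive; [trivial | ring].
    - apply Hg.
    - pose proof (is_derive_difference_quotient _ _ u0 v0 (cos t) (sin t) r _ _ Hr A B) as D.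
      cbv beta in D. fold (u r t) (v r t) in D. fold (P r t) in D.
      replace (p r t) with
       (fst (g1 (x r t, y r t) * (cos t, sin t))%C * cos t +
        snd (g1 (x r t, y r t) * (cos t, sin t))%C * sin t).
      + exact D.
      + unfold p; simpl. generalize (sin2_cos2 t); unfold Rsqr; intros E.
        transitivity (fst (g1 (x r t, y r t)) * (sin t * sin t + cos t * cos t));
          [ring | rewrite E; ring]. }
  assert (DQ : forall r t : R, 0 < r -> is_derive (Q r) t (r * (p r t - P r t))).
  { intros r t Hr.
    destruct (is_cderive_real_path g (x r) (y r) t
       (- r * sin t) (r * cos t) (g1 (x r t, y r t))) as [A B].
    - unfold x; auto_derive; [trivial | ring].
    - unfold y; auto_derive; [trivial | ring].
    - apply Hg.
    - pose proof (is_derive_rotation _ _ u0 v0 t _ _ A B) as D.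
      cbv beta in D. fold (u r t) (v r t) in D.
      replace (r * (p r t - P r t)) with
       (snd (g1 (x r t, y r t) * ((- r * sin t)%R, (r * cos t)%R))%C * cos t -
        fst (g1 (x r t, y r t) * ((- r * sin t)%R, (r * cos t)%R))%C * sin t -
        ((u r t - u0) * cos t + (v r t - v0) * sin t)).
      + exact D.
      + unfold p, P; simpl. generalize (sin2_cos2 t); unfold Rsqr; intros E.
        transitivity (r * (fst (g1 (x r t, y r t)) * (sin t * sin t + cos t * cos t))
          - ((u r t - u0) * cos t + (v r t - v0) * sin t));
          [ring | rewrite E; field; lra]. }
  assert (Cx : forall r t : R, continuity_2d_pt x r t).
  { intros r t; unfold x. apply continuity_2d_pt_plus; [apply continuity_2d_pt_const|].
    apply continuity_2d_pt_mult; [apply continuity_2d_pt_id1|].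
    apply (continuity_1d_2d_pt_comp cos (fun _ t => t));
      [apply continuity_cos | apply continuity_2d_pt_id2]. }
  assert (Cy : forall r t : R, continuity_2d_pt y r t).
  { intros r t; unfold y. apply continuity_2d_pt_plus; [apply continuity_2d_pt_const|].
    apply continuity_2d_pt_mult; [apply continuity_2d_pt_id1|].
    apply (continuity_1d_2d_pt_comp sin (fun _ t => t));
      [apply continuity_sin | apply continuity_2d_pt_id2]. }
  assert (CP : forall r t : R, 0 < r -> continuity_2d_pt P r t).
  { intros r t Hr. unfold P, Rdiv. apply continuity_2d_pt_mult.
    2:{ apply continuity_2d_pt_inv; [apply continuity_2d_pt_id1 | lra]. }
    apply continuity_2d_pt_plus; apply continuity_2d_pt_mult;
      try (apply continuity_2d_pt_minus; [|apply continuity_2d_pt_const]).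
    - exact (proj1 (continuity_2d_pt_cderive g x y r t _ (Hg _) (Cx r t) (Cy r t))).
    - apply (continuity_1d_2d_pt_comp cos (fun _ t => t));
        [apply continuity_cos | apply continuity_2d_pt_id2].
    - exact (proj2 (continuity_2d_pt_cderive g x y r t _ (Hg _) (Cx r t) (Cy r t))).
    - apply (continuity_1d_2d_pt_comp sin (fun _ t => t));
        [apply continuity_sin | apply continuity_2d_pt_id2]. }
  assert (Cp : forall r t : R, 0 < r -> continuity_2d_pt (fun r t => p r t - P r t) r t).
  { intros r t Hr. apply continuity_2d_pt_minus; [|auto].
    exact (proj1 (continuity_2d_pt_cderive g1 x y r t _ (Hg1 _) (Cx r t) (Cy r t))). }
  assert (C1 : forall (F : R -> R -> R) (r t : R), continuity_2d_pt F r t ->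
     continuous (F r) t).
  { intros F r t HF. apply continuity_pt_filterlim. intros eps He.
    destruct (HF (mkposreal eps He)) as [de Hd].
    exists de; split; [apply cond_pos|]. intros t' [_ Ht]. apply Hd; [|exact Ht].
    rewrite Rminus_diag, Rabs_R0; apply cond_pos. }
  assert (I : forall r, 0 < r -> ex_RInt (P r) 0 (2 * PI)).
  { intros r Hr. apply (ex_RInt_continuous (V := R_CompleteNormedModule)).
    intros t _. apply C1, CP, Hr. }
  assert (DH : forall r, 0 < r -> is_derive H r 0).
  { intros r Hr.
    assert (Hloc : forall T : R -> Prop, (forall r, 0 < r -> T r) -> locally r T).
    { intros T HT. exists (mkposreal r Hr). intros r' B. apply HT.
      change (Rabs (r' - r) < r) in B. apply Rabs_def2 in B. lra. }
    replace 0 with (RInt (fun t => Derive (fun u => P u t) r) 0 (2 * PI)).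
    - apply is_derive_RInt_param.
      + apply Hloc. intros r' Hr' t _. eexists; apply DP, Hr'.
      + intros t _. apply continuity_2d_pt_ext_loc with (fun r t => (p r t - P r t) * / r).
        * exists (mkposreal r Hr). intros r' t' B _. simpl in B. symmetry.
          apply is_derive_unique, DP. apply Rabs_def2 in B. lra.
        * apply continuity_2d_pt_mult; [auto|].
          apply continuity_2d_pt_inv; [apply continuity_2d_pt_id1 | lra].
      + apply Hloc. intros r' Hr'. apply I, Hr'.
    - transitivity (RInt (fun t => scal (/ (r * r)) (r * (p r t - P r t))) 0 (2 * PI)).
      + apply RInt_ext. intros t _. replace (Derive (fun u => P u t) r) with ((p r t - P r t) / r)
          by (symmetry; apply is_derive_unique, DP, Hr).
        unfold scal; simpl; unfold mult; simpl. field. lra.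
      + apply is_RInt_unique.
        replace 0 with (scal (/ (r * r)) (minus (Q r (2 * PI)) (Q r 0))) at 2.
        * apply (is_RInt_scal (V := R_NormedModule)).
          apply (is_RInt_derive (V := R_CompleteNormedModule)).
          -- intros t _. apply DQ, Hr.
          -- intros t _. apply (continuous_scal_r r (fun t => p r t - P r t)).
             exact (C1 _ _ _ (Cp r t Hr)).
        * unfold Q, u, v, x, y. rewrite cos_2PI, sin_2PI, cos_0, sin_0.
          unfold scal, minus, plus, opp; simpl; unfold mult; simpl. ring. }
  assert (Hunit : forall t : R, Cmod (cos t, - sin t) = 1).
  { intros t. unfold Cmod; simpl. rewrite <- sqrt_1 at 3. f_equal.
    generalize (sin2_cos2 t); unfold Rsqr; intros E.
    transitivity (sin t * sin t + cos t * cos t); [ring | exact E]. }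
  assert (Hcirc : forall r t : R, 0 < r -> Cmod (r * cos t, r * sin t) = r).
  { intros r t Hr. replace (r * cos t, r * sin t) with (RtoC r * (cos t, (- - sin t)%R))%C
      by (unfold Cmult; simpl; f_equal; ring).
    rewrite Cmod_mult, Cmod_R, Rabs_pos_eq by lra.
    generalize (Hunit (- t)). rewrite cos_neg, sin_neg; intros ->; ring. }
  assert (HP : forall (r t : R) (c : C), 0 < r -> P r t - fst c =
     fst ((g ((x0, y0) + ((r * cos t)%R, (r * sin t)%R)) - g (x0, y0)
        - c * ((r * cos t)%R, (r * sin t)%R)) * (cos t, (- sin t)%R))%C / r).
  { intros r t c Hr. unfold P.
    change ((x0, y0) + ((r * cos t)%R, (r * sin t)%R))%C with (x r t, y r t).
    simpl. fold (u r t) (v r t) u0 v0. generalize (sin2_cos2 t); unfold Rsqr; intros E.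
    transitivity (((u r t - u0) * cos t + (v r t - v0) * sin t -
      r * fst c * (sin t * sin t + cos t * cos t)) / r); [rewrite E|]; field; lra. }
  assert (HPle : forall (r t B : R) (c : C), 0 < r ->
     Cmod (g ((x0, y0) + ((r * cos t)%R, (r * sin t)%R)) - g (x0, y0)
        - c * ((r * cos t)%R, (r * sin t)%R))%C <= B -> Rabs (P r t - fst c) <= B / r).
  { intros r t B c Hr HB. rewrite (HP r t c Hr). unfold Rdiv.
    rewrite Rabs_mult, (Rabs_pos_eq (/ r)) by (left; apply Rinv_0_lt_compat; lra).
    apply Rmult_le_compat_r; [left; apply Rinv_0_lt_compat; lra|].
    eapply Rle_trans; [apply Rabs_fst_le_Cmod|]. rewrite Cmod_mult, Hunit. lra. }
  pose proof PI_RGT_0 as PPI.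
  assert (HHrho : Rabs (H rho) <= 2 * PI * (2 * M / rho)).
  { replace (2 * PI) with (2 * PI - 0) at 1 by ring.
    apply abs_RInt_le_const; [lra | auto |]. intros t _.
    replace (P rho t) with (P rho t - fst (RtoC 0)) by (simpl; ring).
    apply HPle; [auto|].
    replace (_ - 0 * _)%C with (g ((x0, y0) + ((rho * cos t)%R, (rho * sin t)%R))%C
      + - g ((x0, y0) + 0)%C)%C.
    - eapply Rle_trans; [apply Cmod_triangle|]. rewrite Cmod_opp.
      replace (2 * M) with (M + M) by ring. apply Rplus_le_compat; apply HM.
      + rewrite Hcirc; lra.
      + rewrite Cmod_0; lra.
    - replace (Cplus (x0, y0) 0) with (x0, y0) by (unfold Cplus; simpl; f_equal; ring).
      ring. }
  apply le_epsilon. intros eps He.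
  destruct (Hg (x0, y0) eps He) as [de [Pd Hd]].
  set (r := Rmin (de / 2) rho).
  assert (Hr : 0 < r) by (apply Rmin_pos; lra).
  assert (r1 : r <= de / 2) by apply Rmin_l. assert (r2 : r <= rho) by apply Rmin_r.
  assert (HHr : H r = H rho).
  { destruct r2 as [r2|r2]; [|rewrite r2; reflexivity].
    apply (eq_is_derive (V := R_NormedModule)); [|exact r2].
    intros t Ht. apply DH. lra. }
  assert (K : Rabs (RInt (fun t => P r t - fst (g1 (x0, y0))) 0 (2 * PI))
     <= (2 * PI - 0) * eps).
  { apply abs_RInt_le_const; [lra | |].
    - apply (ex_RInt_minus (V := R_NormedModule)); [auto | apply ex_RInt_const].
    - intros t _. replace eps with (eps * r / r) by (field; lra).
      apply HPle; [auto|]. specialize (Hd ((r * cos t)%R, (r * sin t)%R)).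
      rewrite (Hcirc r t Hr) in Hd. apply Hd. lra. }
  replace (RInt (fun t => P r t - fst (g1 (x0, y0))) 0 (2 * PI))
     with (H rho - 2 * PI * fst (g1 (x0, y0))) in K.
  2:{ rewrite <- HHr. symmetry.
      transitivity (minus (RInt (P r) 0 (2 * PI))
         (RInt (fun _ => fst (g1 (x0, y0))) 0 (2 * PI))).
      - apply (RInt_minus (V := R_CompleteNormedModule)); [auto | apply ex_RInt_const].
      - rewrite RInt_const. unfold H, minus, plus, opp, scal; simpl.
        unfold mult; simpl. ring. }
  apply Rmult_le_reg_l with (2 * PI); [lra|].
  replace (2 * PI * Rabs (fst (g1 (x0, y0)))) with (Rabs (2 * PI * fst (g1 (x0, y0))))
    by (rewrite Rabs_mult, Rabs_pos_eq; lra).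
  replace (2 * PI * fst (g1 (x0, y0))) with
    (H rho + - (H rho - 2 * PI * fst (g1 (x0, y0)))) by ring.
  eapply Rle_trans; [apply Rabs_triang|]. rewrite Rabs_Ropp. lra.
Qed.

(** Applying the bound for real parts to g and to -i g controls both components of the derivative,
    at the price of a factor 2. The function [g2] provides the continuity of [g1] used to
    differentiate under the integral sign. *)
Lemma cauchy_estimate (g g1 g2 : C -> C) (w0 : C) (rho M : R) :
  (forall w, is_cderive g w (g1 w)) -> (forall w, is_cderive g1 w (g2 w)) ->
  0 < rho -> (forall h, Cmod h <= rho -> Cmod (g (w0 + h)%C) <= M) ->
  Cmod (g1 w0) <= 4 * M / rho.
Proof.
  intros Hg Hg1 Hrho HM.
  pose proof (cauchy_estimate_fst g g1 g2 w0 rho M Hg Hg1 Hrho HM) as H1.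
  pose proof (cauchy_estimate_fst (fun w => - Ci * g w)%C (fun w => - Ci * g1 w)%C
    (fun w => - Ci * g2 w)%C w0 rho M) as H2.
  assert (E : Rabs (fst (- Ci * g1 w0)%C) <= 2 * M / rho).
  { apply H2; auto; try (intros w; apply is_cderive_scal; auto).
    intros h Hh. rewrite Cmod_mult, Cmod_opp.
    replace (Cmod Ci) with 1; [rewrite Rmult_1_l; auto|].
    unfold Cmod, Ci; simpl. rewrite <- sqrt_1 at 1; f_equal; ring. }
  replace (fst (- Ci * g1 w0)%C) with (snd (g1 w0)) in E by (simpl; ring).
  eapply Rle_trans; [apply Cmod_le_Rabs|]. unfold Rdiv in *. lra.
Qed.

(** * Iterated Cauchy estimates in the logarithmic coordinate *)

Lemma exp_partial_sum_le (x : R) (n : nat) :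
  0 <= x -> sum_f_R0 (fun i => / INR (fact i) * x ^ i) n <= exp x.
Proof.
  intros Hx. apply sum_incr.
  - unfold exp. destruct (exist_exp x) as [l Hl]; simpl. exact Hl.
  - intros i. apply Rmult_le_pos; [|apply pow_le; auto].
    left; apply Rinv_0_lt_compat, INR_fact_lt_0.
Qed.

(** A single term of the exponential series; at x = n it gives n^n <= n! e^n, which stands in for
    Stirling's formula. *)
Lemma pow_le_fact_exp (x : R) (n : nat) :
  0 <= x -> x ^ n <= INR (fact n) * exp x.
Proof.
  intros Hx. pose proof (INR_fact_lt_0 n) as P.
  apply Rmult_le_reg_l with (/ INR (fact n)); [apply Rinv_0_lt_compat; auto|].
  rewrite <- Rmult_assoc, Rinv_l, Rmult_1_l by lra.
  eapply Rle_trans; [|apply (exp_partial_sum_le x n Hx)].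
  destruct n as [|n]; [simpl; lra|]. rewrite tech5.
  assert (0 <= sum_f_R0 (fun i => / INR (fact i) * x ^ i) n); [|lra].
  apply cond_pos_sum. intros i. apply Rmult_le_pos; [|apply pow_le; auto].
  left; apply Rinv_0_lt_compat, INR_fact_lt_0.
Qed.

Lemma exp_mult_INR (x : R) (n : nat) : exp (INR n * x) = exp x ^ n.
Proof.
  induction n as [|n IH]; [simpl; rewrite Rmult_0_l; apply exp_0|].
  rewrite S_INR. replace ((INR n + 1) * x) with (x + INR n * x) by ring.
  rewrite exp_plus, IH; reflexivity.
Qed.

Lemma exp_le_exp (x y : R) : x <= y -> exp x <= exp y.
Proof. intros [H|H]; [left; apply exp_increasing; auto | rewrite H; lra]. Qed.

(* [G n] is the [n]-th derivative of [G 0] with respect to [z], read in the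
   coordinate [w = log z]. *)
Definition derivative_chain (G : nat -> C -> C) : Prop :=
  forall n w, is_cderive (G n) w (cexp w * G (S n) w).

Lemma derivative_chain_plus (G H : nat -> C -> C) :
  derivative_chain G -> derivative_chain H ->
  derivative_chain (fun n w => G n w + H n w)%C.
Proof.
  intros HG HH n w.
  replace (cexp w * (G (S n) w + H (S n) w))%C with
    (cexp w * G (S n) w + cexp w * H (S n) w)%C by ring.
  apply is_cderive_plus; auto.
Qed.

Lemma derivative_chain_second (G : nat -> C -> C) :
  derivative_chain G -> forall n w, is_cderive (fun w => cexp w * G (S n) w)%C w
    (cexp w * G (S n) w + cexp w * (cexp w * G (S (S n)) w))%C.
Proof. intros HG n w. apply is_cderive_mult; [apply is_cderive_cexp | apply HG]. Qed.

(** One Cauchy estimate per derivative, on discs of radius [rho] in the w-plane. Each narrows the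
    strip by [rho] and costs at most e^(k rho) by the variation of |z| over the disc; division by
    |e^w| passes from d/dw to d/dz and lowers the power of |z| by one. *)
Lemma derivative_chain_iterated_cauchy (G : nat -> C -> C) (sigma rho M : R) (k : nat) :
  derivative_chain G -> 0 < rho -> 0 <= M ->
  (forall w, Rabs (snd w) <= sigma -> Cmod (G O w) <= M * exp (INR k * fst w)) ->
  forall j, (j <= k)%nat -> forall w, Rabs (snd w) <= sigma - INR j * rho ->
  Cmod (G j w) <=
    M * (4 / rho) ^ j * exp (INR j * (INR k * rho)) * exp ((INR k - INR j) * fst w).
Proof.
  intros HG Hrho HM H0. induction j as [|j IH]; intros Hj w Hw.
  - simpl in *. rewrite !Rmult_0_l, exp_0, !Rmult_1_r, Rminus_0_r.
    apply H0. lra.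
  - specialize (IH ltac:(lia)).
    assert (Hjk : INR j + 1 <= INR k) by (rewrite <- S_INR; apply le_INR; lia).
    pose proof (pos_INR j) as Pj. rewrite S_INR in *.
    set (B := M * (4 / rho) ^ j * exp (INR j * (INR k * rho))).
    assert (P4 : 0 < 4 / rho) by (apply Rdiv_lt_0_compat; lra).
    assert (HB : 0 <= B).
    { unfold B. repeat apply Rmult_le_pos; auto; [apply pow_le; lra | left; apply exp_pos]. }
    pose proof (cauchy_estimate (G j) (fun w => cexp w * G (S j) w)%C _ w rho
      (B * exp ((INR k - INR j) * (fst w + rho))) (HG j)
      (derivative_chain_second G HG j) Hrho) as K.
    cbv beta in K. rewrite Cmod_mult, Cmod_cexp in K.
    assert (K' : exp (fst w) * Cmod (G (S j) w) <=
      4 * (B * exp ((INR k - INR j) * (fst w + rho))) / rho).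
    { apply K. intros h Hh.
      pose proof (Rabs_fst_le_Cmod h). pose proof (Rabs_snd_le_Cmod h).
      eapply Rle_trans; [apply IH|].
      - unfold Cplus; simpl. eapply Rle_trans; [apply Rabs_triang|]. lra.
      - apply Rmult_le_compat_l; [exact HB|]. apply exp_le_exp.
        apply Rmult_le_compat_l; [lra|]. unfold Cplus; simpl.
        pose proof (Rle_abs (fst h)). lra. }
    apply Rmult_le_reg_l with (exp (fst w)); [apply exp_pos|].
    eapply Rle_trans; [apply K'|].
    apply Rle_trans with (B * (4 / rho) * exp (INR k * rho) * exp ((INR k - INR j) * fst w)).
    + replace (4 * (B * exp ((INR k - INR j) * (fst w + rho))) / rho) with
        (B * (4 / rho) * exp ((INR k - INR j) * rho) * exp ((INR k - INR j) * fst w)).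
      * apply Rmult_le_compat_r; [left; apply exp_pos|].
        apply Rmult_le_compat_l; [apply Rmult_le_pos; lra|].
        apply exp_le_exp. apply Rmult_le_compat_r; lra.
      * rewrite Rmult_plus_distr_l, exp_plus. field. lra.
    + apply Req_le. unfold B.
      replace ((INR k - INR j) * fst w) with
        (fst w + (INR k - (INR j + 1)) * fst w) by ring.
      rewrite Rmult_plus_distr_r, Rmult_1_l, !exp_plus. simpl. ring.
Qed.

(** The radius eps/n makes n steps consume exactly eps of the strip, and n^n <= n! e^n turns
    (4n/eps)^n into a factorial. The case n = 0, where this radius makes no sense, is separate. *)
Lemma derivative_chain_cauchy (G : nat -> C -> C) (sigma eps M : R) (k n : nat) :
  derivative_chain G -> 0 < eps -> 0 <= M -> (n <= k)%nat ->
  (forall w, Rabs (snd w) <= sigma -> Cmod (G O w) <= M * exp (INR k * fst w)) ->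
  forall w, Rabs (snd w) <= sigma - eps ->
  Cmod (G n w) <= M * (4 * exp 1 / eps) ^ n * INR (fact n) * exp (INR k * eps)
     * exp ((INR k - INR n) * fst w).
Proof.
  intros HG He HM Hn H0 w Hw. destruct n as [|n].
  - simpl. rewrite !Rmult_1_r, Rminus_0_r.
    rewrite Rmult_assoc. rewrite (Rmult_comm (exp _)), <- Rmult_assoc.
    rewrite <- (Rmult_1_r (Cmod _)). apply Rmult_le_compat; try lra; [apply Cmod_ge_0| |].
    + apply H0. lra.
    + rewrite <- exp_0. apply exp_le_exp. apply Rmult_le_pos; [apply pos_INR | lra].
  - set (N := S n) in *. assert (PN : 0 < INR N) by (apply lt_0_INR; unfold N; lia).
    assert (Hr : 0 < eps / INR N) by (apply Rdiv_lt_0_compat; lra).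
    pose proof (derivative_chain_iterated_cauchy G sigma (eps / INR N) M k HG Hr HM H0
      N Hn w) as K.
    replace (INR N * (eps / INR N)) with eps in K by (field; lra).
    replace (INR N * (INR k * (eps / INR N))) with (INR k * eps) in K by (field; lra).
    eapply Rle_trans; [apply K, Hw|].
    apply Rmult_le_compat_r; [left; apply exp_pos|].
    apply Rmult_le_compat_r; [left; apply exp_pos|]. rewrite (Rmult_assoc M).
    apply Rmult_le_compat_l; [exact HM|].
    replace (4 / (eps / INR N)) with (4 / eps * INR N) by (field; lra).
    replace (4 * exp 1 / eps) with (4 / eps * exp 1) by (field; lra).
    rewrite !Rpow_mult_distr, Rmult_assoc.
    apply Rmult_le_compat_l; [apply pow_le; left; apply Rdiv_lt_0_compat; lra|].
    rewrite <- (exp_mult_INR 1), Rmult_1_r, Rmult_comm. apply pow_le_fact_exp. lra.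
Qed.

(** * The incomplete Gamma cutoff *)

(** The argument counts terms: the top degree is n - 1, so that 1 - e^(-v) [exp_trunc n v] vanishes
    to order n at 0. *)
Fixpoint exp_trunc (n : nat) (v : C) : C :=
  match n with
  | O => 0%C
  | S m => (exp_trunc m v + v ^ m / INR (fact m))%C
  end.

(* [1 - gamma_upper n v] is the normalised lower incomplete Gamma function
   (1 / (n-1)!) int_0^v s^(n-1) e^(-s) ds. *)
Definition gamma_upper (n : nat) (v : C) : C := (cexp (- v) * exp_trunc n v)%C.

Lemma RtoC_neq_0 (x : R) : x <> 0 -> RtoC x <> 0%C.
Proof. intros H E. apply RtoC_inj in E. auto. Qed.

Lemma RtoC_fact_neq_0 (n : nat) : RtoC (INR (fact n)) <> 0%C.
Proof. apply RtoC_neq_0, INR_fact_neq_0. Qed.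

Lemma is_cderive_cexp_opp (v : C) : is_cderive (fun v => cexp (- v)) v (- cexp (- v)).
Proof.
  replace (- cexp (- v))%C with (cexp (- v) * (-1 * 1))%C by ring.
  apply (is_cderive_comp cexp); [apply is_cderive_cexp|].
  apply is_cderive_ext with (fun v => -1 * v)%C; [intros w; ring|].
  apply is_cderive_scal, is_cderive_id.
Qed.

Lemma is_cderive_pow (n : nat) (v : C) :
  is_cderive (fun v => v ^ S n)%C v (INR (S n) * v ^ n)%C.
Proof.
  induction n as [|n IH].
  - apply is_cderive_ext with (fun v => v); [intros w; simpl; ring|].
    replace (INR 1 * v ^ 0)%C with (RtoC 1) by (simpl; ring). apply is_cderive_id.
  - apply is_cderive_ext with (fun v => v * v ^ S n)%C; [intros w; reflexivity|].
    replace (INR (S (S n)) * v ^ S n)%C with (1 * v ^ S n + v * (INR (S n) * v ^ n))%C.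
    + apply is_cderive_mult; [apply is_cderive_id | exact IH].
    + rewrite (S_INR (S n)), RtoC_plus. simpl (v ^ S n)%C. ring.
Qed.

(** Differentiating e^(-v) times the partial sum telescopes: only the top-degree term survives. *)
Lemma is_cderive_gamma_upper (n : nat) (v : C) :
  is_cderive (gamma_upper (S n)) v (- cexp (- v) * (v ^ n / INR (fact n)))%C.
Proof.
  induction n as [|n IH].
  - apply is_cderive_ext with (fun v => cexp (- v)).
    + intros w. unfold gamma_upper. simpl. field.
    + replace (- cexp (- v) * (v ^ 0 / INR (fact 0)))%C with (- cexp (- v))%C
        by (simpl; field).
      apply is_cderive_cexp_opp.
  - pose proof (RtoC_fact_neq_0 n) as F0. pose proof (RtoC_fact_neq_0 (S n)) as F1.
    assert (F2 : RtoC (INR (S n)) <> 0%C).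
    { intros E. apply RtoC_inj in E. apply (not_0_INR (S n)); [lia | exact E]. }
    apply is_cderive_ext with
      (fun v => gamma_upper (S n) v + / INR (fact (S n)) * (cexp (- v) * v ^ S n))%C.
    + intros w. unfold gamma_upper.
      change (exp_trunc (S (S n)) w) with (exp_trunc (S n) w + w ^ S n / INR (fact (S n)))%C.
      field. exact F1.
    + replace (- cexp (- v) * (v ^ S n / INR (fact (S n))))%C with
       (- cexp (- v) * (v ^ n / INR (fact n)) + / INR (fact (S n)) *
          (- cexp (- v) * v ^ S n + cexp (- v) * (INR (S n) * v ^ n)))%C.
      * apply is_cderive_plus; [exact IH|]. apply is_cderive_scal.
        apply (is_cderive_mult (fun v => cexp (- v)) (fun v => v ^ S n)%C);
          [apply is_cderive_cexp_opp | apply is_cderive_pow].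
      * rewrite fact_simpl, mult_INR, RtoC_mult. field. split; auto.
Qed.

Lemma gamma_upper_0 (n : nat) : gamma_upper (S n) 0 = 1%C.
Proof.
  unfold gamma_upper. replace (- 0)%C with (RtoC 0) by ring. rewrite cexp_0.
  replace (exp_trunc (S n) 0) with (RtoC 1); [ring|].
  induction n as [|n IH].
  - simpl. field.
  - change (exp_trunc (S (S n)) 0) with (exp_trunc (S n) 0 + 0 ^ S n / INR (fact (S n)))%C.
    rewrite <- IH. simpl (0 ^ S n)%C. field. apply RtoC_fact_neq_0.
Qed.

(** Mean value theorem on the segment from 0 to v, where |e^(-tv)| <= 1 because Re v >= 0. The
    factor 2 comes from treating the two components separately. *)
Lemma gamma_lower_small (n : nat) (v : C) :
  0 <= fst v ->
  Cmod (1 - gamma_upper (S n) v)%C <= 2 * (Cmod v ^ S n / INR (fact n)).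
Proof.
  intros Hv. set (K := Cmod v ^ S n / INR (fact n)).
  set (D := fun t : R => (- cexp (- (t * fst v, t * snd v)%R) *
     ((t * fst v, t * snd v)%R ^ n / INR (fact n)) * v)%C).
  assert (HD : forall t, is_derive (fun t => fst (gamma_upper (S n) (t * fst v, t * snd v)))
       t (fst (D t)) /\
     is_derive (fun t => snd (gamma_upper (S n) (t * fst v, t * snd v))) t (snd (D t))).
  { intros t. unfold D. destruct v as [x y].
    apply (is_cderive_real_path (gamma_upper (S n)) (fun t => t * x) (fun t => t * y) t x y);
      [auto_derive; [trivial | ring] .. | apply is_cderive_gamma_upper]. }
  assert (HK : forall t, 0 <= t <= 1 -> Cmod (D t) <= K).
  { intros t Ht. unfold D, K.
    replace (t * fst v, t * snd v) with (RtoC t * v)%C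
      by (destruct v; unfold Cmult; simpl; f_equal; ring).
    rewrite !Cmod_mult, Cmod_opp, Cmod_cexp. unfold Cdiv.
    rewrite Cmod_mult, Cmod_inv by apply RtoC_fact_neq_0.
    rewrite Cmod_pow, Cmod_mult, !Cmod_R.
    pose proof (INR_fact_lt_0 n) as F. pose proof (Cmod_ge_0 v) as P.
    rewrite (Rabs_pos_eq (INR (fact n))), (Rabs_pos_eq t) by lra.
    simpl (Cmod v ^ S n). unfold Rdiv.
    replace (Cmod v * Cmod v ^ n * / INR (fact n)) with
      (1 * (Cmod v ^ n * / INR (fact n)) * Cmod v) by ring.
    apply Rmult_le_compat_r; [exact P|].
    assert (PI : 0 <= / INR (fact n)) by (left; apply Rinv_0_lt_compat; auto).
    apply Rmult_le_compat.
    - left; apply exp_pos.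
    - apply Rmult_le_pos; [apply pow_le, Rmult_le_pos; lra | exact PI].
    - rewrite <- exp_0. apply exp_le_exp. simpl. nra.
    - apply Rmult_le_compat_r; [exact PI|]. apply pow_incr. nra. }
  assert (HB : forall h dh : R -> R, (forall t, is_derive h t (dh t)) ->
     (forall t, 0 <= t <= 1 -> Rabs (dh t) <= K) -> Rabs (h 1 - h 0) <= K).
  { intros h dh H1 H2.
    destruct (MVT_gen h 0 1 dh) as [c [Hc E]].
    - intros t _. apply H1.
    - intros t _. apply derivable_continuous_pt. exists (dh t).
      apply is_derive_Reals, H1.
    - rewrite Rmin_left, Rmax_right in Hc by lra. rewrite E.
      replace (dh c * (1 - 0)) with (dh c) by ring. auto. }
  assert (E1 : (1 * fst v, 1 * snd v) = v) by (destruct v; simpl; f_equal; ring).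
  assert (E0 : (0 * fst v, 0 * snd v) = RtoC 0) by (unfold RtoC; f_equal; ring).
  pose proof (HB _ _ (fun t => proj1 (HD t))
    (fun t Ht => Rle_trans _ _ _ (Rabs_fst_le_Cmod _) (HK t Ht))) as B1.
  pose proof (HB _ _ (fun t => proj2 (HD t))
    (fun t Ht => Rle_trans _ _ _ (Rabs_snd_le_Cmod _) (HK t Ht))) as B2.
  cbv beta in B1, B2. rewrite E1, E0, gamma_upper_0 in B1, B2.
  eapply Rle_trans; [apply Cmod_le_Rabs|].
  rewrite Rabs_minus_sym in B1. rewrite Rabs_minus_sym in B2.
  unfold Cminus, Cplus, Copp; simpl. simpl in B1, B2. unfold Rminus in *. lra.
Qed.

(** From n^n <= n! e^n and n <= 2^n, 1/(n-1)! is at most (2e/n)^n. *)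
Lemma gamma_lower_le (n : nat) (v : C) :
  0 <= fst v -> (0 < n)%nat ->
  Cmod (1 - gamma_upper n v)%C <= 2 * (2 * exp 1 * (Cmod v / INR n)) ^ n.
Proof.
  intros Hv Hn. destruct n as [|n]; [lia|].
  eapply Rle_trans; [apply gamma_lower_small, Hv|].
  apply Rmult_le_compat_l; [lra|].
  assert (PN : 0 < INR (S n)) by (apply lt_0_INR; lia).
  pose proof (INR_fact_lt_0 n) as F. pose proof (exp_pos 1) as PE.
  replace (2 * exp 1 * (Cmod v / INR (S n))) with (Cmod v * (2 * exp 1 / INR (S n)))
    by (field; lra).
  rewrite Rpow_mult_distr. apply Rmult_le_compat_l; [apply pow_le, Cmod_ge_0|].
  unfold Rdiv. rewrite !Rpow_mult_distr, pow_inv.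
  apply Rmult_le_reg_r with (INR (fact n) * INR (S n) ^ S n).
  { apply Rmult_lt_0_compat; [auto | apply pow_lt; auto]. }
  replace (/ INR (fact n) * (INR (fact n) * INR (S n) ^ S n)) with (INR (S n) ^ S n)
    by (field; lra).
  replace (2 ^ S n * exp 1 ^ S n * / INR (S n) ^ S n * (INR (fact n) * INR (S n) ^ S n))
    with (2 ^ S n * (exp 1 ^ S n * INR (fact n)))
    by (field; apply pow_nonzero; lra).
  eapply Rle_trans; [apply pow_le_fact_exp; lra|].
  rewrite <- (exp_mult_INR 1), Rmult_1_r, fact_simpl, mult_INR.
  assert (Q : INR (S n) <= 2 ^ S n).
  { rewrite <- (pow_INR 2). apply le_INR. clear.
    apply Nat.lt_le_incl, Nat.pow_gt_lin_r; lia. }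
  pose proof (exp_pos (INR (S n))).
  replace (INR (S n) * INR (fact n) * exp (INR (S n)))
    with (INR (S n) * (exp (INR (S n)) * INR (fact n))) by ring.
  apply Rmult_le_compat_r; [nra | exact Q].
Qed.

(** Writing |v|^i = delta^(-i) (delta |v|)^i bounds the truncated exponential by delta^(-n) e^(delta
    |v|). The hypothesis gives |e^(-v)| <= e^(-2 delta |v|), so one half of the decay remains. *)
Lemma gamma_upper_le (n : nat) (v : C) (delta : R) :
  0 < delta <= 1 -> 2 * delta * Cmod v <= fst v ->
  Cmod (gamma_upper n v) <= (/ delta) ^ n * exp (- (delta * Cmod v)).
Proof.
  intros Hd Hv. pose proof (Cmod_ge_0 v) as P.
  assert (Pi : 1 <= / delta).
  { rewrite <- Rinv_1. apply Rinv_le_contravar; lra. }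
  assert (HE : Cmod (exp_trunc n v) <= (/ delta) ^ n * exp (delta * Cmod v)).
  { destruct n as [|n].
    - simpl. rewrite Cmod_0, Rmult_1_l. left; apply exp_pos.
    - apply Rle_trans with ((/ delta) ^ n *
        sum_f_R0 (fun i => / INR (fact i) * (delta * Cmod v) ^ i) n).
      + induction n as [|n IH].
        * simpl. replace (0 + 1 / 1)%C with (RtoC 1) by field.
          rewrite Cmod_1. lra.
        * change (exp_trunc (S (S n)) v)
            with (exp_trunc (S n) v + v ^ S n / INR (fact (S n)))%C.
          eapply Rle_trans; [apply Cmod_triangle|]. rewrite tech5, Rmult_plus_distr_l.
          apply Rplus_le_compat.
          -- eapply Rle_trans; [apply IH|]. apply Rmult_le_compat_r.
             ++ apply cond_pos_sum. intros i. apply Rmult_le_pos.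
                ** left; apply Rinv_0_lt_compat, INR_fact_lt_0.
                ** apply pow_le, Rmult_le_pos; lra.
             ++ apply Rle_pow; [exact Pi | lia].
          -- unfold Cdiv. rewrite Cmod_mult, Cmod_inv, Cmod_pow by apply RtoC_fact_neq_0.
             rewrite Cmod_R, Rabs_pos_eq by (left; apply INR_fact_lt_0).
             rewrite Rpow_mult_distr, pow_inv. apply Req_le. field.
             split; [apply INR_fact_neq_0 | apply pow_nonzero; lra].
      + apply Rmult_le_compat.
        * apply pow_le; lra.
        * apply cond_pos_sum. intros i. apply Rmult_le_pos.
          -- left; apply Rinv_0_lt_compat, INR_fact_lt_0.
          -- apply pow_le, Rmult_le_pos; lra.
        * apply Rle_pow; [exact Pi | lia].
        * apply exp_partial_sum_le. apply Rmult_le_pos; lra. }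
  unfold gamma_upper. rewrite Cmod_mult, Cmod_cexp.
  eapply Rle_trans; [apply Rmult_le_compat_l; [left; apply exp_pos | apply HE]|].
  rewrite <- Rmult_assoc, (Rmult_comm (exp _)), Rmult_assoc, <- exp_plus.
  apply Rmult_le_compat_l; [apply pow_le; lra|]. apply exp_le_exp. simpl. lra.
Qed.

(** * The building blocks *)

(* [z ^ alpha], read in the coordinate [w = log z]. *)
Definition zpow (alpha : R) (w : C) : C := cexp (alpha * w).

Lemma Cmod_zpow alpha w : Cmod (zpow alpha w) = exp (alpha * fst w).
Proof. unfold zpow. rewrite Cmod_cexp. simpl. f_equal. ring. Qed.

Lemma zpow_plus alpha beta w : zpow (alpha + beta) w = (zpow alpha w * zpow beta w)%C.
Proof. unfold zpow. rewrite <- cexp_plus, RtoC_plus. f_equal. ring. Qed.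

Lemma zpow_0 w : zpow 0 w = 1%C.
Proof. unfold zpow. rewrite Cmult_0_l. apply cexp_0. Qed.

Lemma zpow_1 w : zpow 1 w = cexp w.
Proof. unfold zpow. rewrite Cmult_1_l. reflexivity. Qed.

Lemma is_cderive_zpow alpha w : is_cderive (zpow alpha) w (alpha * zpow alpha w).
Proof.
  replace (alpha * zpow alpha w)%C with (cexp (alpha * w) * (alpha * 1))%C
    by (unfold zpow; ring).
  apply (is_cderive_comp cexp (fun w => alpha * w)%C); [apply is_cderive_cexp|].
  apply is_cderive_scal, is_cderive_id.
Qed.

Fixpoint falling (x : R) (n : nat) : R :=
  match n with O => 1 | S m => falling x m * (x - INR m) end.

Lemma falling_diag (n : nat) : falling (INR n) n = INR (fact n).
Proof.
  (* Base and number of factors are decoupled, because the recursion of [falling] keeps its base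
     fixed. *)
  assert (H : forall k m, falling (INR (m + k)) k * INR (fact m) = INR (fact (m + k))).
  { induction k as [|k IH]; intros m.
    - rewrite Nat.add_0_r. simpl. ring.
    - simpl falling. specialize (IH (S m)).
      replace (S m + k)%nat with (m + S k)%nat in IH by lia. rewrite <- IH, fact_simpl, mult_INR.
      replace (INR (m + S k) - INR k) with (INR (S m)).
      + ring.
      + rewrite plus_INR, !S_INR. ring. }
  specialize (H n O). simpl in H. rewrite <- H. ring.
Qed.

Lemma falling_0 (p n : nat) : (p < n)%nat -> falling (INR p) n = 0.
Proof.
  induction 1 as [|n H IH]; simpl.
  - ring.
  - rewrite IH. ring.
Qed.

Definition monomial_chain (p n : nat) (w : C) : C :=
  (falling (INR p) n * zpow (INR p - INR n) w)%C.

Lemma monomial_chain_spec (p : nat) : derivative_chain (monomial_chain p).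
Proof.
  intros n w. unfold monomial_chain.
  replace (cexp w * _)%C with
    (falling (INR p) n * ((INR p - INR n)%R * zpow (INR p - INR n) w))%C.
  - apply is_cderive_scal, is_cderive_zpow.
  - rewrite S_INR. simpl falling. rewrite RtoC_mult.
    replace (INR p - INR n) with (1 + (INR p - (INR n + 1))) at 2 by ring.
    rewrite zpow_plus, zpow_1. ring.
Qed.

(* A pair [(c, alpha)] stands for [c z^alpha exp(- V z^(-a))]; the span of these
   functions is stable under d/dz. *)
Definition eterm (a V : R) (t : R * R) (w : C) : C :=
  (fst t * cexp (snd t * w - V * zpow (- a) w))%C.

Fixpoint elist (a V : R) (l : list (R * R)) (w : C) : C :=
  match l with
  | nil => 0%C
  | t :: l' => (eterm a V t w + elist a V l' w)%C
  end.

(** The first new term differentiates z^alpha; the second differentiates the exponential, which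
    brings out a V z^(-a-1). *)
Fixpoint elist_deriv (a V : R) (l : list (R * R)) : list (R * R) :=
  match l with
  | nil => nil
  | t :: l' => (fst t * snd t, snd t - 1)
      :: (fst t * (a * V), snd t - a - 1) :: elist_deriv a V l'
  end.

Lemma is_cderive_eterm a V t w :
  is_cderive (eterm a V t) w
    (cexp w * (eterm a V (fst t * snd t, snd t - 1)%R w +
       eterm a V (fst t * (a * V), snd t - a - 1)%R w))%C.
Proof.
  destruct t as [c alpha]. unfold eterm; simpl.
  set (X := (V * zpow (- a) w)%C).
  replace (cexp w * _)%C with
    (c * (cexp (alpha * w - X) * (alpha * 1 + - V * (- a * zpow (- a) w))))%C.
  - apply is_cderive_scal.
    apply (is_cderive_comp cexp (fun w => alpha * w - V * zpow (- a) w)%C);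
      [apply is_cderive_cexp|].
    apply is_cderive_ext with (fun w => alpha * w + - V * zpow (- a) w)%C;
      [intros z; ring|].
    apply is_cderive_plus; apply is_cderive_scal; [apply is_cderive_id|].
    rewrite <- RtoC_opp. apply is_cderive_zpow.
  - replace ((alpha - 1)%R * w - X)%C with ((alpha * w - X) + -1 * w)%C
      by (rewrite RtoC_minus; ring).
    replace ((alpha - a - 1)%R * w - X)%C with ((alpha * w - X) + (- a * w + -1 * w))%C
      by (rewrite !RtoC_minus; ring).
    rewrite !cexp_plus. unfold zpow. rewrite RtoC_opp, !RtoC_mult.
    assert (E : (cexp w * cexp (-1 * w) = 1)%C).
    { rewrite <- cexp_plus, <- cexp_0. f_equal. ring. }
    transitivity (c * cexp (alpha * w - X) * (alpha + a * V * cexp (- a * w))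
       * (cexp w * cexp (-1 * w)))%C; [rewrite E|]; ring.
Qed.

Lemma elist_chain_spec a V l :
  derivative_chain (fun n => elist a V (Nat.iter n (elist_deriv a V) l)).
Proof.
  intros n w. simpl.
  generalize (Nat.iter n (elist_deriv a V) l) as L.
  induction L as [|t L IH]; simpl.
  - rewrite Cmult_0_r. apply is_cderive_const.
  - replace (cexp w * _)%C with
     (cexp w * (eterm a V (fst t * snd t, snd t - 1)%R w +
       eterm a V (fst t * (a * V), snd t - a - 1)%R w)
       + cexp w * elist a V (elist_deriv a V L) w)%C by ring.
    apply is_cderive_plus; [apply is_cderive_eterm | exact IH].
Qed.

(** Only the cutoff part of the block: z^p is kept apart so that [block_remainder] can drop it. *)
Fixpoint cutoff_list (a V : R) (p N : nat) : list (R * R) :=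
  match N with
  | O => nil
  | S m => (- (V ^ m / INR (fact m)), INR p - a * INR m) :: cutoff_list a V p m
  end.

Lemma cutoff_list_spec a V p N w :
  elist a V (cutoff_list a V p N) w =
  (- (zpow (INR p) w * gamma_upper N (V * zpow (- a) w)))%C.
Proof.
  unfold gamma_upper. set (v := (V * zpow (- a) w)%C).
  induction N as [|N IH]; simpl.
  - ring.
  - rewrite IH. unfold eterm; simpl. fold v.
    replace (cexp ((INR p - a * INR N)%R * w - v)) with
      (zpow (INR p) w * (cexp (- v) * zpow (- a) w ^ N))%C.
    + assert (Ev : (v ^ N = V ^ N * zpow (- a) w ^ N)%C) by apply Cpow_mult_l.
      rewrite Ev, RtoC_opp, RtoC_div, RtoC_pow
        by apply INR_fact_neq_0.
      field. apply RtoC_fact_neq_0.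
    + replace (zpow (- a) w ^ N)%C with (zpow (- a * INR N) w).
      * unfold zpow. rewrite <- !cexp_plus. f_equal.
        rewrite RtoC_minus, !RtoC_mult, RtoC_opp. ring.
      * clear. induction N as [|N IH]; [simpl; rewrite Rmult_0_r; apply zpow_0|].
        rewrite S_INR, Rmult_plus_distr_l, Rmult_1_r, zpow_plus, IH. simpl. ring.
Qed.

(* The chain of derivatives of the building block
   T_p(z) = z^p (1 - gamma_upper N (V z^(-a))), minus [z^p] when [p < k]. *)
Definition block_remainder (a V : R) (p N k n : nat) (w : C) : C :=
  ((if Nat.ltb p k then 0 else monomial_chain p n w) +
   elist a V (Nat.iter n (elist_deriv a V) (cutoff_list a V p N)) w)%C.

Definition block (a V : R) (p N : nat) : nat -> C -> C := block_remainder a V p N 0.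

Lemma block_remainder_chain a V p N k : derivative_chain (block_remainder a V p N k).
Proof.
  unfold block_remainder. apply derivative_chain_plus; [|apply elist_chain_spec].
  destruct (Nat.ltb p k); [|apply monomial_chain_spec].
  intros n w. rewrite Cmult_0_r. apply is_cderive_const.
Qed.

Lemma block_remainder_high a V p N k w : (k <= p)%nat ->
  block_remainder a V p N k 0 w =
  (zpow (INR p) w * (1 - gamma_upper N (V * zpow (- a) w)))%C.
Proof.
  intros H. unfold block_remainder, monomial_chain.
  rewrite (proj2 (Nat.ltb_ge p k) H). simpl. rewrite cutoff_list_spec, Rminus_0_r. ring.
Qed.

Lemma block_remainder_low a V p N k w : (p < k)%nat ->
  block_remainder a V p N k 0 w =
  (- (zpow (INR p) w * gamma_upper N (V * zpow (- a) w)))%C.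
Proof.
  intros H. unfold block_remainder.
  rewrite (proj2 (Nat.ltb_lt p k) H). simpl. rewrite cutoff_list_spec. ring.
Qed.

(** The monomial dropped when p < n has zero n-th derivative. *)
Lemma block_remainder_diag a V p N n w :
  block_remainder a V p N n n w = block a V p N n w.
Proof.
  unfold block, block_remainder. simpl. destruct (Nat.ltb_spec p n) as [H|H]; [|reflexivity].
  unfold monomial_chain. rewrite falling_0 by auto. ring.
Qed.

(** Among the monomials dropped, only z^n has a nonzero n-th derivative, the constant n!. The
    remainder of order n + 1 thus measures the distance of the n-th derivative to its limit at 0. *)
Lemma block_remainder_succ a V p N n w :
  block_remainder a V p N (S n) n w =
  (block a V p N n w - (if Nat.eqb p n then INR (fact n) else 0))%C.
Proof.
  unfold block, block_remainder. change (Nat.ltb p 0) with false. cbv iota.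
  destruct (Nat.eqb_spec p n) as [->|Hn].
  - rewrite (proj2 (Nat.ltb_lt n (S n))) by lia. unfold monomial_chain.
    rewrite falling_diag, Rminus_diag, zpow_0. ring.
  - destruct (Nat.ltb_spec p (S n)) as [H|H]; [|ring].
    unfold monomial_chain. rewrite falling_0 by lia. ring.
Qed.

Lemma Cmod_real_pow_arg (V a : R) (w : C) : 0 <= V ->
  Cmod (V * zpow (- a) w)%C = V * exp (- a * fst w) /\
  fst (V * zpow (- a) w)%C = V * exp (- a * fst w) * cos (a * snd w).
Proof.
  intros HV. split.
  - rewrite Cmod_mult, Cmod_R, Rabs_pos_eq, Cmod_zpow; auto.
  - unfold zpow, cexp; simpl.
    replace (- a * fst w - 0 * snd w) with (- a * fst w) by ring.
    replace (- a * snd w + 0 * fst w) with (- (a * snd w)) by ring.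
    rewrite cos_neg. ring.
Qed.

(** * Size of the cutoff and of the remainders *)

Lemma exp_INR_ln (x : R) (n : nat) : 0 < x -> x ^ n = exp (INR n * ln x).
Proof. intros H. rewrite exp_mult_INR, exp_ln; auto. Qed.

(* With [u = log (r / |z|)] one has [|v| = m e^(a u)]: the cutoff is close to 1
   for [|z| < r], and of size [(r / |z|)^m] for [|z| > r]. *)
Lemma cutoff_bounds (a delta : R) : 0 < a -> 0 < delta <= 1 / 2 ->
  exists lambda, 0 <= lambda /\ forall (m u : R) (N : nat) (v : C),
    1 <= m -> m <= a * INR N -> INR N <= m / a + 1 ->
    Cmod v = m * exp (a * u) -> 2 * delta * Cmod v <= fst v ->
    Cmod (1 - gamma_upper N v)%C <= 2 * exp (lambda * m) /\
    (u <= 0 -> Cmod (1 - gamma_upper N v)%C <= 2 * exp (lambda * m + m * u)) /\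
    Cmod (gamma_upper N v) <= exp (lambda * m - delta * (m * exp (a * u))).
Proof.
  (* [D] dominates both bases raised to the power N: 1/delta from [gamma_upper_le], and 2 e a from
     [gamma_lower_le], where |v|/N <= a e^(a u). As m >= 1, N <= (1/a + 1) m, whence the witness for
     [lambda]. *)
  intros Ha Hd. set (D := / delta + 2 * exp 1 * a).
  pose proof (exp_pos 1) as E1.
  assert (Pd : 2 <= / delta).
  { replace 2 with (/ (1 / 2)) by field. apply Rinv_le_contravar; lra. }
  assert (PEa : 0 < 2 * exp 1 * a) by (apply Rmult_lt_0_compat; lra).
  assert (PD : 2 <= D) by (unfold D; lra).
  assert (PL : 0 <= ln D) by (rewrite <- ln_1; left; apply ln_increasing; lra).
  exists ((/ a + 1) * ln D). pose proof (Rinv_0_lt_compat a Ha) as Pa.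
  split; [apply Rmult_le_pos; lra|].
  intros m u N v Hm HN1 HN2 Hv Hre.
  assert (PN : (0 < N)%nat).
  { destruct N; [simpl in HN1; lra | lia]. }
  assert (PIN : 0 < INR N) by (apply lt_0_INR; auto).
  assert (HDN : forall x, 0 <= x <= D -> x ^ N <= exp ((/ a + 1) * ln D * m)).
  { intros x Hx. apply Rle_trans with (D ^ N); [apply pow_incr; exact Hx|].
    rewrite exp_INR_ln by lra. apply exp_le_exp.
    apply Rle_trans with ((m / a + 1) * ln D); [apply Rmult_le_compat_r; lra|].
    replace ((/ a + 1) * ln D * m) with ((m / a + m) * ln D) by (unfold Rdiv; ring).
    apply Rmult_le_compat_r; lra. }
  pose proof (exp_pos (a * u)) as Eau.
  assert (Pv : 0 <= Cmod v) by apply Cmod_ge_0.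
  assert (HG : Cmod (gamma_upper N v) <= exp ((/ a + 1) * ln D * m - delta * (m * exp (a * u)))).
  { eapply Rle_trans; [apply (gamma_upper_le N v delta); lra|].
    unfold Rminus. rewrite exp_plus, Hv.
    apply Rmult_le_compat_r; [left; apply exp_pos|]. apply HDN. unfold D. lra. }
  repeat split.
  - replace (1 - gamma_upper N v)%C with (1 + - gamma_upper N v)%C by ring.
    eapply Rle_trans; [apply Cmod_triangle|]. rewrite Cmod_opp, Cmod_1.
    assert (1 <= exp ((/ a + 1) * ln D * m)).
    { rewrite <- exp_0 at 1. apply exp_le_exp. apply Rmult_le_pos; [|lra].
      apply Rmult_le_pos; lra. }
    assert (exp ((/ a + 1) * ln D * m - delta * (m * exp (a * u)))
       <= exp ((/ a + 1) * ln D * m)); [|lra].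
    apply exp_le_exp. assert (0 <= delta * (m * exp (a * u))); [|lra].
    repeat apply Rmult_le_pos; lra.
  - intros Hu.
    eapply Rle_trans; [apply gamma_lower_le; [nra | exact PN]|].
    apply Rmult_le_compat_l; [lra|].
    apply Rle_trans with ((2 * exp 1 * a) ^ N * exp (a * u) ^ N).
    + rewrite <- Rpow_mult_distr. apply pow_incr. split.
      * apply Rmult_le_pos; [lra|]. apply Rdiv_le_0_compat; auto.
      * rewrite (Rmult_assoc (2 * exp 1) a). apply Rmult_le_compat_l; [lra|].
        rewrite Hv. apply Rmult_le_reg_r with (INR N); [auto|].
        replace (m * exp (a * u) / INR N * INR N) with (m * exp (a * u)) by (field; lra).
        nra.
    + rewrite exp_plus. apply Rmult_le_compat; try (apply pow_le; lra).
      * apply HDN. unfold D. lra.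
      * rewrite <- exp_mult_INR. apply exp_le_exp. nra.
  - exact HG.
Qed.

(** The inequality e^x >= 1 + x at x = a u + tau, with tau chosen so that x = 0 at the maximum of
    the left side in u. The true maximum is smaller by j/a. *)
Lemma mul_sub_exp_le (a c j u : R) : 0 < a -> 0 < c -> 0 < j ->
  j * u - c * exp (a * u) <= j / a * (ln j - ln (a * c)).
Proof.
  intros Ha Hc Hj.
  assert (Hac : 0 < a * c) by (apply Rmult_lt_0_compat; auto).
  set (tau := ln (a * c) - ln j).
  assert (E : c * exp (a * u) = j / a * exp (a * u + tau)).
  { unfold tau, Rminus. rewrite !exp_plus, exp_Ropp, !exp_ln by auto. field. lra. }
  rewrite E. pose proof (exp_ineq1_le (a * u + tau)) as I.
  replace (ln j - ln (a * c)) with (- tau) by (unfold tau; ring).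
  assert (P : 0 < j / a) by (apply Rdiv_lt_0_compat; auto).
  replace (j * u) with (j / a * (a * u)) by (field; lra).
  nra.
Qed.

(* Here [rho = log r]. *)
Lemma block_remainder_bounds (a sigma delta : R) :
  0 < a -> 0 < delta <= 1 / 2 ->
  (forall t, Rabs t <= sigma -> 2 * delta <= cos (a * t)) ->
  exists lambda, 0 <= lambda /\ forall (m rho : R) (N p k : nat) (w : C),
    INR p + 1 <= m -> m <= a * INR N -> INR N <= m / a + 1 -> Rabs (snd w) <= sigma ->
    ((k <= p)%nat -> Cmod (block_remainder a (m * exp (a * rho)) p N k 0 w) <=
       2 * exp (lambda * m + INR k * fst w + (INR p - INR k) * rho)) /\
    ((p < k)%nat -> Cmod (block_remainder a (m * exp (a * rho)) p N k 0 w) <=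
       exp (lambda * m + lambda * INR k + INR k * fst w - (INR k - INR p) * rho
         + (INR k - INR p) / a * ln (INR k / m))).
Proof.
  intros Ha Hd Hcos.
  destruct (cutoff_bounds a delta Ha Hd) as [l1 [Pl1 H1]].
  (* Pays for the constant a delta inside the logarithm given by [mul_sub_exp_le]. *)
  set (l2 := Rabs (ln (a * delta)) / a).
  assert (Pl2 : 0 <= l2) by (apply Rdiv_le_0_compat; [apply Rabs_pos | auto]).
  exists (l1 + l2). split; [lra|].
  intros m rho N p k w Hm HN1 HN2 Hw.
  pose proof (pos_INR p) as Pp. pose proof (pos_INR k) as Pk.
  set (u := rho - fst w). set (v := ((m * exp (a * rho))%R * zpow (- a) w)%C).
  assert (PV : 0 <= m * exp (a * rho)).
  { apply Rmult_le_pos; [lra | left; apply exp_pos]. }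
  destruct (Cmod_real_pow_arg _ a w PV) as [V1 V2]. fold v in V1, V2.
  assert (Hv : Cmod v = m * exp (a * u)).
  { rewrite V1, Rmult_assoc, <- exp_plus. do 2 f_equal. unfold u; ring. }
  rewrite <- V1 in V2.
  assert (Hre : 2 * delta * Cmod v <= fst v).
  { rewrite V2, (Rmult_comm (Cmod v)). apply Rmult_le_compat_r; [apply Cmod_ge_0 | auto]. }
  destruct (H1 m u N v) as [B1 [B2 B3]]; auto; [lra|].
  split; intros Hkp.
  - rewrite block_remainder_high by auto. fold v. rewrite Cmod_mult, Cmod_zpow.
    assert (Hkp' : INR k <= INR p) by (apply le_INR; auto).
    assert (M0 : 0 <= l2 * m) by (apply Rmult_le_pos; lra).
    destruct (Rle_or_lt u 0) as [Hu|Hu].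
    + eapply Rle_trans; [apply Rmult_le_compat_l; [left; apply exp_pos | apply B2, Hu]|].
      rewrite (Rmult_comm (exp _)), Rmult_assoc, <- exp_plus.
      apply Rmult_le_compat_l; [lra|]. apply exp_le_exp.
      assert ((m - INR p + INR k) * u <= 0) by nra.
      unfold u in *. nra.
    + eapply Rle_trans; [apply Rmult_le_compat_l; [left; apply exp_pos | apply B1]|].
      rewrite (Rmult_comm (exp _)), Rmult_assoc, <- exp_plus.
      apply Rmult_le_compat_l; [lra|]. apply exp_le_exp.
      assert (0 <= (INR p - INR k) * u) by nra.
      unfold u in *. nra.
  - rewrite block_remainder_low by auto. fold v. rewrite Cmod_opp, Cmod_mult, Cmod_zpow.
    eapply Rle_trans; [apply Rmult_le_compat_l; [left; apply exp_pos | apply B3]|].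
    rewrite <- exp_plus. apply exp_le_exp.
    assert (Hkp' : INR p + 1 <= INR k) by (rewrite <- S_INR; apply le_INR; auto).
    set (j := INR k - INR p) in *.
    (* Here |z|^p exceeds |z|^k near 0 by the factor |z|^(-j); the decay e^(-delta m e^(a u)) of the
       truncated exponential has to beat it. *)
    pose proof (mul_sub_exp_le a (delta * m) j u Ha ltac:(nra) ltac:(unfold j; lra)) as K.
    assert (Q : j / a * (ln j - ln (a * (delta * m))) <=
       j / a * ln (INR k / m) + l2 * INR k).
    { replace (a * (delta * m)) with (a * delta * m) by ring.
      rewrite ln_mult by nra.
      replace (ln (INR k / m)) with (ln (INR k) - ln m) by (rewrite ln_div; lra).
      assert (L : ln j <= ln (INR k)) by (apply ln_le; unfold j; lra).
      assert (Pj : 0 < j / a) by (apply Rdiv_lt_0_compat; unfold j; lra).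
      pose proof (Rle_abs (- ln (a * delta))) as A. rewrite Rabs_Ropp in A.
      assert (l2 * j <= l2 * INR k) by (apply Rmult_le_compat_l; unfold j; lra).
      assert (j / a * (- ln (a * delta)) <= j / a * Rabs (ln (a * delta)))
        by (apply Rmult_le_compat_l; lra).
      assert (j / a * Rabs (ln (a * delta)) = l2 * j) by (unfold l2; field; lra).
      nra. }
    assert (M0 : 0 <= l2 * m) by (apply Rmult_le_pos; lra).
    assert (M1 : 0 <= l1 * INR k) by (apply Rmult_le_pos; lra).
    assert (Eu : j * u = j * rho - j * fst w) by (unfold u; ring).
    assert (Ej : j * fst w = INR k * fst w - INR p * fst w) by (unfold j; ring).
    lra.
Qed.

(** A binomial coefficient is at least 1. *)
Lemma fact_mult_le (j k : nat) :
  INR (fact k) * INR (fact j) <= INR (fact (j + k)).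
Proof.
  induction j as [|j IH].
  - simpl. lra.
  - rewrite Nat.add_succ_l, !fact_simpl, !mult_INR.
    pose proof (INR_fact_lt_0 k). pose proof (INR_fact_lt_0 j).
    assert (INR (S j) <= INR (S (j + k))) by (apply le_INR; lia).
    assert (0 < INR (S j)) by (apply lt_0_INR; lia).
    replace (INR (fact k) * (INR (S j) * INR (fact j)))
      with (INR (S j) * (INR (fact k) * INR (fact j))) by ring.
    apply Rmult_le_compat; try lra. apply Rmult_le_pos; lra.
Qed.

Lemma fact_le_pow (j p : nat) (K : R) : INR (j + p) <= K ->
  INR (fact (j + p)) <= K ^ j * INR (fact p).
Proof.
  induction j as [|j IH]; intros HK.
  - simpl. lra.
  - rewrite Nat.add_succ_l, fact_simpl, mult_INR. simpl pow. rewrite Rmult_assoc.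
    rewrite Nat.add_succ_l in HK.
    apply Rmult_le_compat; try exact HK; try apply pos_INR.
    apply IH. rewrite S_INR in HK. lra.
Qed.

(** Here [y] stands for log Q, [Omega] for omega(Q)/l and [W] for the weight of index p. In both
    cases r enters with exponent p - k: its factor 1/Q turns Q^p into Q^k, its factor m is weighed
    against p!/k!, and its factor eta yields the geometric decay. *)
Lemma block_weighted_bound (a sigma delta : R) :
  0 < a -> 0 < delta <= 1 / 2 ->
  (forall t, Rabs t <= sigma -> 2 * delta <= cos (a * t)) ->
  exists eta L, 0 < eta < 1 /\ 0 <= L /\
  forall (Omega y W m : R) (N p k : nat) (w : C),
    0 <= Omega -> 0 <= W -> W <= exp (1 + INR p * y - Omega) ->
    m = INR p + 1 + eta * Omega -> m <= a * INR N -> INR N <= m / a + 1 ->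
    Rabs (snd w) <= sigma ->
    W / INR (fact p) *
      Cmod (block_remainder a (m * exp (a * (ln eta + ln m - y))) p N k 0 w) <=
    exp (L + L * INR k - INR p * ln 2 + INR k * y
      + (1 + / a) * Rmax 0 (ln (INR k / m)) * INR k - Omega / 2)
      / INR (fact k) * exp (INR k * fst w).
Proof.
  intros Ha Hd Hcos.
  destruct (block_remainder_bounds a sigma delta Ha Hd Hcos) as [l [Pl H]].
  (* In [l3], l comes from the block bound and 1 from the e^m in m^(p-k) <= (p-k)! e^m. In -log eta,
     one [l3] pays for e^(l3 p), [ln 2] produces 2^(-p), and the other [l3] helps to make l3 eta <=
     1/2. *)
  set (l3 := l + 1). set (h := - (l3 + ln 2 + l3)).
  assert (L2 : 0 < ln 2) by (rewrite <- ln_1; apply ln_increasing; lra).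
  set (eta := exp h).
  assert (Peta : 0 < eta) by apply exp_pos.
  assert (Eh : ln eta = h) by apply ln_exp.
  assert (Peta2 : l3 * eta <= 1 / 2).
  { unfold eta, h. rewrite exp_Ropp. pose proof (exp_ineq1_le (l3 + ln 2 + l3)) as I.
    apply Rmult_le_reg_r with (exp (l3 + ln 2 + l3)); [apply exp_pos|].
    rewrite Rmult_assoc, Rinv_l by (apply Rgt_not_eq, exp_pos). unfold l3 in *. lra. }
  exists eta, (1 + ln 2 + l3 + l3 + ln 2 + l - h).
  split; [split; [exact Peta|]|split].
  { rewrite <- exp_0. apply exp_increasing. unfold h, l3. lra. }
  { unfold h, l3. lra. }
  intros Omega y W m N p k w PO PW HW Hm HN1 HN2 Hw.
  pose proof (pos_INR p) as Pp. pose proof (pos_INR k) as Pk.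
  assert (POe : 0 <= eta * Omega) by (apply Rmult_le_pos; lra).
  set (rho := ln eta + ln m - y).
  destruct (H m rho N p k w ltac:(lra) HN1 HN2 Hw) as [HH HL].
  pose proof (INR_fact_lt_0 p) as Fp. pose proof (INR_fact_lt_0 k) as Fk.
  assert (Pm : 1 <= m) by lra.
  assert (Hlm : l3 * m <= l3 * INR p + l3 + Omega / 2).
  { rewrite Hm. assert (l3 * (eta * Omega) <= Omega / 2) by nra. lra. }
  pose proof (Rmax_l 0 (ln (INR k / m))) as S0.
  pose proof (Rmax_r 0 (ln (INR k / m))) as S1.
  set (S := Rmax 0 (ln (INR k / m))) in *.
  pose proof (Rinv_0_lt_compat a Ha) as Pa.
  (* The two cases differ only in the block bound e^X and in the price e^(-E) of replacing 1/p! by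
     1/k!; what is left is a comparison of exponents. *)
  assert (Main : forall X E, Cmod (block_remainder a (m * exp (a * rho)) p N k 0 w) <= exp X ->
    exp E / INR (fact p) <= / INR (fact k) ->
    1 + INR p * y - Omega + X <= E + (1 + ln 2 + l3 + l3 + ln 2 + l - h +
     (1 + ln 2 + l3 + l3 + ln 2 + l - h) * INR k - INR p * ln 2 + INR k * y +
     (1 + / a) * S * INR k - Omega / 2 + INR k * fst w) ->
    W / INR (fact p) * Cmod (block_remainder a (m * exp (a * rho)) p N k 0 w) <=
    exp (1 + ln 2 + l3 + l3 + ln 2 + l - h +
     (1 + ln 2 + l3 + l3 + ln 2 + l - h) * INR k - INR p * ln 2 + INR k * y +
     (1 + / a) * S * INR k - Omega / 2) / INR (fact k) * exp (INR k * fst w)).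
  { intros X E HX HE HXE.
    set (B := 1 + ln 2 + l3 + l3 + ln 2 + l - h +
     (1 + ln 2 + l3 + l3 + ln 2 + l - h) * INR k - INR p * ln 2 + INR k * y +
     (1 + / a) * S * INR k - Omega / 2) in *.
    apply Rle_trans with (exp (1 + INR p * y - Omega) / INR (fact p) * exp X).
    - apply Rmult_le_compat; auto; [|apply Cmod_ge_0|].
      + apply Rdiv_le_0_compat; auto.
      + apply Rmult_le_compat_r; auto. left; apply Rinv_0_lt_compat; auto.
    - apply Rle_trans with (exp (B + INR k * fst w) * (exp E / INR (fact p))).
      + unfold Rdiv. rewrite <- Rmult_assoc, <- exp_plus.
        replace (exp (1 + INR p * y - Omega) * / INR (fact p) * exp X) with
          (exp (1 + INR p * y - Omega) * exp X * / INR (fact p)) by ring.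
        rewrite <- exp_plus. apply Rmult_le_compat_r.
        * left; apply Rinv_0_lt_compat; auto.
        * apply exp_le_exp. lra.
      + eapply Rle_trans; [apply Rmult_le_compat_l; [left; apply exp_pos | apply HE]|].
        rewrite exp_plus. apply Req_le. unfold Rdiv. ring. }
  assert (Ess : forall x, 0 <= x -> 0 <= x * S * INR k).
  { intros x Hx. repeat apply Rmult_le_pos; auto. }
  destruct (Nat.le_gt_cases k p) as [Hkp|Hkp].
  - assert (Hkp' : INR k <= INR p) by (apply le_INR; auto).
    (* [E] comes from m^(p-k) <= (p-k)! e^m <= (p!/k!) e^m. *)
    apply (Main (ln 2 + (l * m + INR k * fst w + (INR p - INR k) * rho))
      (INR (p - k) * ln m - m)).
    + rewrite exp_plus, exp_ln by lra. apply HH, Hkp.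
    + unfold Rminus. rewrite exp_plus, <- exp_INR_ln, exp_Ropp by lra.
      pose proof (pow_le_fact_exp m (p - k) ltac:(lra)) as I1.
      pose proof (fact_mult_le (p - k) k) as I2.
      replace (p - k + k)%nat with p in I2 by lia.
      pose proof (INR_fact_lt_0 (p - k)) as Fj. pose proof (exp_pos m) as Em.
      apply Rle_trans with (INR (fact (p - k)) / INR (fact p)).
      * apply Rmult_le_compat_r; [left; apply Rinv_0_lt_compat; auto|].
        apply Rmult_le_reg_r with (exp m); auto.
        rewrite Rmult_assoc, Rinv_l by lra. lra.
      * apply Rmult_le_reg_r with (INR (fact p) * INR (fact k)); [nra|].
        replace (INR (fact (p - k)) / INR (fact p) * (INR (fact p) * INR (fact k)))
          with (INR (fact k) * INR (fact (p - k))) by (field; lra).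
        replace (/ INR (fact k) * (INR (fact p) * INR (fact k))) with (INR (fact p))
          by (field; lra). exact I2.
    + rewrite minus_INR by auto. unfold rho. rewrite Eh.
      specialize (Ess (1 + / a) ltac:(lra)).
      assert (X1 : (INR p - INR k) * h <= - ((INR p - INR k) * (l3 + ln 2))).
      { unfold h. assert (0 <= (INR p - INR k) * l3) by
          (apply Rmult_le_pos; unfold l3; lra). lra. }
      assert (X2 : 0 <= (1 + l3 + ln 2 + l - h - ln 2) * INR k).
      { apply Rmult_le_pos; [unfold h, l3; lra | auto]. }
      assert (X3 : l3 * m = l * m + m) by (unfold l3; ring).
      assert (X4 : 0 <= 1 + l3 + l - h - 1) by (unfold h, l3; lra).
      assert (X5 : (l3 + ln 2) * INR k + (1 + l3 + ln 2 + l - h - ln 2) * INR k + ln 2 * INR k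
        = (1 + ln 2 + l3 + l3 + ln 2 + l - h) * INR k) by ring.
      assert (X6 : 0 <= ln 2 * INR k) by (apply Rmult_le_pos; lra).
      lra.
  - assert (Hkp' : INR p + 1 <= INR k) by (rewrite <- S_INR; apply le_INR; auto).
    set (j := INR k - INR p) in *.
    (* [E] comes from k! <= k^(k-p) p!. *)
    apply (Main (l * m + l * INR k + INR k * fst w - j * rho + j / a * ln (INR k / m))
      (- (j * ln (INR k)))).
    + apply HL, Hkp.
    + rewrite exp_Ropp. unfold j. rewrite <- minus_INR, <- exp_INR_ln by (lia || lra).
      pose proof (fact_le_pow (k - p) p (INR k)) as I.
      replace (k - p + p)%nat with k in I by lia. specialize (I (Rle_refl _)).
      assert (PP : 0 < INR k ^ (k - p)) by (apply pow_lt; lra).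
      unfold Rdiv. rewrite <- Rinv_mult. apply Rinv_le_contravar; auto.
    + assert (X1 : ln (INR k / m) = ln (INR k) - ln m) by (rewrite ln_div; lra).
      unfold rho. rewrite Eh.
      (* [X2] accounts for the factorials against m^(k-p), [X3] for the cutoff: these are the
         summands 1 and 1/a in the exponent of s. *)
      assert (X2 : j * ln (INR k / m) <= INR k * S).
      { apply Rle_trans with (j * S); [apply Rmult_le_compat_l; unfold j; lra|].
        apply Rmult_le_compat_r; unfold j; lra. }
      assert (X3 : j / a * ln (INR k / m) <= / a * S * INR k).
      { replace (j / a * ln (INR k / m)) with (/ a * (j * ln (INR k / m))) by (field; lra).
        rewrite Rmult_assoc. apply Rmult_le_compat_l; lra. }
      assert (X4 : - (j * h) <= - h * INR k).
      { assert (0 <= INR p * - h) by (apply Rmult_le_pos; unfold h, l3; lra).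
        unfold j; lra. }
      assert (X5 : l * m <= l3 * m) by (unfold l3; lra).
      assert (X6 : l3 * INR p <= l3 * INR k) by (apply Rmult_le_compat_l; unfold l3; lra).
      assert (X7 : INR p * ln 2 <= ln 2 * INR k)
        by (rewrite Rmult_comm; apply Rmult_le_compat_l; lra).
      assert (X8 : 0 <= (1 + ln 2 + l3) * INR k) by (apply Rmult_le_pos; unfold l3; lra).
      assert (X9 : 0 <= ln 2 + l3 + ln 2 + l - h) by (unfold h, l3; lra).
      replace ((1 + / a) * S * INR k) with (INR k * S + / a * S * INR k) by ring.
      replace ((1 + ln 2 + l3 + l3 + ln 2 + l - h) * INR k) with
        ((1 + ln 2 + l3) * INR k + l3 * INR k + ln 2 * INR k + l * INR k + - h * INR k) by ring.
      assert (X10 : j * y = INR k * y - INR p * y) by (unfold j; ring).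
      assert (X11 : j * ln (INR k / m) = j * ln (INR k) - j * ln m) by (rewrite X1; ring).
      lra.
Qed.

(** * Weights *)

Lemma nat_ceil (x : R) : 0 <= x -> exists n, x <= INR n <= x + 1.
Proof.
  intros Hx. destruct (nfloor_ex x Hx) as [n Hn]. exists (S n). rewrite S_INR. lra.
Qed.

(** An index above gamma + 1 yields g and K with omega(K^g t) <= K omega(t) for large t. About
    tau/(g log K) iterations multiply the argument by e^tau and the value by about e^(tau/g). The
    added 1 covers small arguments, where omega may vanish. *)
Lemma growth_from_index (omega : R -> R) (gamma : R) :
  W0 omega -> 0 < gamma -> Rbar_lt gamma (Rbar_minus (growth_index omega) 1) ->
  exists g M, gamma + 1 < g /\ 1 <= M /\ forall tau y, 0 <= tau ->
    omega (exp (y + tau)) <= M * exp (tau / g) * (omega (exp y) + 1).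
Proof.
  intros [[_ [Hpos [Hmono [_ Hlim]]]] _] Hg Hidx.
  assert (Hidx' : Rbar_lt (gamma + 1) (growth_index omega)).
  { destruct (growth_index omega); simpl in *; auto. lra. }
  unfold growth_index in Hidx'.
  match type of Hidx' with Rbar_lt _ (Lub_Rbar ?E) =>
    destruct (Lub_Rbar_correct E) as [_ HL] end.
  destruct (classic (exists g, gamma + 1 < g /\ exists K, 1 < K /\
       Rbar_lt (limsup_infty (fun t => omega (Rpower K g * t) / omega t)) K))
    as [[g [Hgg [K [HK Hls]]]]|Hno].
  2:{ exfalso. apply (Rbar_lt_not_le _ _ Hidx'). apply HL.
      intros x [->|[_ [K HK]]]; simpl; [lra|].
      apply Rnot_lt_le. intros Hx. apply Hno. exists x; split; [exact Hx | exists K; exact HK]. }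
  unfold limsup_infty in Hls.
  match type of Hls with Rbar_lt (Rbar_glb ?E) _ =>
    destruct (Rbar_ex_glb E) as [gl Hgl]; rewrite (Rbar_is_glb_unique E gl Hgl) in Hls;
    destruct Hgl as [_ HG] end.
  destruct (classic (exists T, Rbar_lt (Lub_Rbar (fun v => exists t, T <= t /\
      v = omega (Rpower K g * t) / omega t)) K)) as [[T HT]|Hno].
  2:{ exfalso. apply (Rbar_lt_not_le _ _ Hls). apply HG.
      intros m [T ->]. apply Rbar_not_lt_le. intros Hm. apply Hno. exists T; exact Hm. }
  match type of HT with Rbar_lt (Lub_Rbar ?E) _ =>
    destruct (Lub_Rbar_correct E) as [HU _] end.
  apply is_lim_spec in Hlim. destruct (Hlim 0) as [T' HT'].
  (* Beyond [T0] the quotient bound holds and omega is positive; positivity holds only for t > T',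
     hence T' + 1. *)
  set (T0 := Rmax 1 (Rmax T (T' + 1))).
  assert (T1 : 1 <= T0 /\ T <= T0 /\ T' + 1 <= T0).
  { unfold T0. generalize (Rmax_l 1 (Rmax T (T' + 1))) (Rmax_r 1 (Rmax T (T' + 1)))
      (Rmax_l T (T' + 1)) (Rmax_r T (T' + 1)). lra. }
  assert (Step : forall t, T0 <= t -> omega (Rpower K g * t) <= K * omega t).
  { intros t Ht. assert (P : 0 < omega t) by (apply HT'; lra).
    assert (Q : Rbar_lt (omega (Rpower K g * t) / omega t) K).
    { eapply Rbar_le_lt_trans; [|exact HT]. apply HU. exists t; split; [lra | reflexivity]. }
    simpl in Q. apply Rmult_lt_compat_r with (r := omega t) in Q; auto.
    replace (omega (Rpower K g * t) / omega t * omega t) with (omega (Rpower K g * t)) in Q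
      by (field; lra). lra. }
  set (kap := ln K).
  assert (Pk : 0 < kap) by (unfold kap; rewrite <- ln_1; apply ln_increasing; lra).
  assert (Pgk : 0 < g * kap) by (apply Rmult_lt_0_compat; lra).
  set (y0 := ln T0). assert (E0 : exp y0 = T0) by (apply exp_ln; lra).
  assert (Iter : forall j y, y0 <= y ->
     omega (exp (y + INR j * (g * kap))) <= K ^ j * omega (exp y)).
  { induction j as [|j IH]; intros y Hy.
    - simpl. rewrite Rmult_0_l, Rplus_0_r. lra.
    - rewrite S_INR. replace (y + (INR j + 1) * (g * kap)) with
        (g * ln K + (y + INR j * (g * kap))) by (unfold kap; ring).
      rewrite exp_plus. eapply Rle_trans.
      + apply Step. rewrite <- E0. apply exp_le_exp.
        assert (0 <= INR j * (g * kap)) by (apply Rmult_le_pos; [apply pos_INR | lra]). lra.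
      + simpl. rewrite Rmult_assoc. apply Rmult_le_compat_l; [lra | auto]. }
  (* The factor [K] pays for rounding the number of iterations up, and 1 + omega(T0) for starting
     them at max(y, log T0). *)
  exists g, (K * (1 + omega T0)). split; [exact Hgg|].
  assert (P0 : 0 <= omega T0) by (apply Hpos; lra). split; [nra|].
  intros tau y Htau.
  destruct (nat_ceil (tau / (g * kap))) as [j [Hj1 Hj2]].
  { apply Rdiv_le_0_compat; lra. }
  assert (Hj : tau <= INR j * (g * kap)).
  { apply Rmult_le_compat_r with (r := g * kap) in Hj1; [|lra].
    replace (tau / (g * kap) * (g * kap)) with tau in Hj1 by (field; lra). exact Hj1. }
  assert (HKj : K ^ j <= K * exp (tau / g)).
  { rewrite exp_INR_ln by lra. rewrite <- (exp_ln K) at 2 by lra. rewrite <- exp_plus.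
    apply exp_le_exp. fold kap.
    apply Rmult_le_compat_r with (r := kap) in Hj2; [|lra].
    replace ((tau / (g * kap) + 1) * kap) with (kap + tau / g) in Hj2 by (field; lra).
    exact Hj2. }
  set (ym := Rmax y y0).
  pose proof (Rmax_l y y0) as L1. pose proof (Rmax_r y y0) as L2. fold ym in L1, L2.
  pose proof (Hpos (exp y) ltac:(left; apply exp_pos)) as Py.
  apply Rle_trans with (K ^ j * omega (exp ym)).
  - eapply Rle_trans; [|apply Iter; exact L2].
    apply Hmono; [left; apply exp_pos|]. apply exp_le_exp. lra.
  - assert (Hym : omega (exp ym) <= omega (exp y) + omega T0).
    { unfold ym, Rmax. destruct (Rle_dec y y0); [rewrite E0|]; lra. }
    apply Rle_trans with (K * exp (tau / g) * (omega (exp y) + omega T0)).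
    + apply Rmult_le_compat; auto.
      * apply pow_le; lra.
      * apply Hpos; left; apply exp_pos.
    + pose proof (exp_pos (tau / g)) as Pe.
      replace (K * (1 + omega T0) * exp (tau / g) * (omega (exp y) + 1)) with
        (K * exp (tau / g) * ((1 + omega T0) * (omega (exp y) + 1))) by ring.
      apply Rmult_le_compat_l; [nra|]. nra.
Qed.

(** As log t = o(omega(t)), (x + 1) y <= omega(e^y) for large y, so x y - omega(e^y) is nonpositive
    there and bounded on the remaining y >= 0. The supremum is finite and [real] loses nothing. *)
Lemma phi_star_correct (omega : R -> R) (x : R) :
  W0 omega -> 0 <= x ->
  is_lub_Rbar (fun v => exists y, 0 <= y /\ v = x * y - phi omega y) (phi_star omega x).
Proof.
  intros [[_ [Hpos _]] [_ [Hdom _]]] Hx. unfold phi_star.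
  match goal with |- is_lub_Rbar ?E _ => pose proof (Lub_Rbar_correct E) as HL end.
  assert (P : 0 < / (x + 1)) by (apply Rinv_0_lt_compat; lra).
  destruct (Hdom (mkposreal _ P)) as [T HT].
  set (B := x * ln (Rmax 1 T)).
  assert (HB : forall y, 0 <= y -> x * y - phi omega y <= Rmax 0 B).
  { intros y Hy. unfold phi. pose proof (Hpos (exp y) ltac:(left; apply exp_pos)) as Po.
    destruct (Rlt_or_le T (exp y)) as [Hty|Hty].
    - specialize (HT _ Hty). unfold norm in HT; simpl in HT. unfold abs in HT; simpl in HT.
      rewrite ln_exp, !Rabs_pos_eq in HT by auto.
      apply Rmult_le_compat_l with (r := x + 1) in HT; [|lra].
      replace ((x + 1) * (/ (x + 1) * omega (exp y))) with (omega (exp y)) in HT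
        by (field; lra).
      eapply Rle_trans; [|apply Rmax_l]. lra.
    - eapply Rle_trans; [|apply Rmax_r]. unfold B.
      assert (y <= ln (Rmax 1 T)).
      { rewrite <- (ln_exp y). apply ln_le; [apply exp_pos|].
        eapply Rle_trans; [exact Hty | apply Rmax_r]. }
      nra. }
  destruct HL as [H1 H2].
  match goal with |- is_lub_Rbar ?E _ => set (F := E) in * end.
  assert (H3 : Rbar_le (Lub_Rbar F) (Rmax 0 B)).
  { apply H2. intros v [y [Hy ->]]. apply HB, Hy. }
  assert (H4 : Rbar_le (x * 0 - phi omega 0) (Lub_Rbar F)).
  { apply H1. exists 0. split; [lra | reflexivity]. }
  destruct (Lub_Rbar F); simpl in *; try contradiction. split; auto.
Qed.

Lemma le_weight (omega : R -> R) (l y : R) (n : nat) :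
  W0 omega -> 0 < l -> 0 <= y ->
  exp (INR n * y - omega (exp y) / l) <= weight omega l n.
Proof.
  intros HW Hl Hy. unfold weight. apply exp_le_exp.
  pose proof (pos_INR n).
  destruct (phi_star_correct omega (l * INR n) HW ltac:(nra)) as [H1 _].
  assert (K : Rbar_le (l * INR n * y - phi omega y) (phi_star omega (l * INR n))).
  { apply H1. exists y; split; auto. }
  simpl in K. unfold phi in K.
  replace (INR n * y - omega (exp y) / l) with
    (1 / l * (l * INR n * y - omega (exp y))) by (field; lra).
  apply Rmult_le_compat_l; [apply Rdiv_le_0_compat; lra | exact K].
Qed.

(** A slack of l below the supremum becomes a factor e after division by l, so no maximiser has to
    exist. The resulting y is log Q. *)
Lemma weight_le (omega : R -> R) (l : R) (n : nat) :
  W0 omega -> 0 < l ->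
  exists y, 0 <= y /\ weight omega l n <= exp (1 + INR n * y - omega (exp y) / l).
Proof.
  intros HW Hl. pose proof (pos_INR n).
  destruct (phi_star_correct omega (l * INR n) HW ltac:(nra)) as [_ H2].
  destruct (classic (exists y, 0 <= y /\
    phi_star omega (l * INR n) - l <= l * INR n * y - phi omega y)) as [[y [Hy K]]|Hno].
  - exists y; split; auto. unfold weight. apply exp_le_exp. unfold phi in K.
    replace (1 + INR n * y - omega (exp y) / l) with
      (1 / l * (l + (l * INR n * y - omega (exp y)))) by (field; lra).
    apply Rmult_le_compat_l; [apply Rdiv_le_0_compat; lra | lra].
  - exfalso. assert (K : Rbar_le (phi_star omega (l * INR n)) (phi_star omega (l * INR n) - l)).
    { apply H2. intros v [y [Hy ->]]. simpl. apply Rnot_lt_le. intros Hv.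
      apply Hno. exists y; split; auto. lra. }
    simpl in K. lra.
Qed.

(* Multiplying [Q = e^y] by [s e^(L + c)], [s = max(1, k / m)^beta], costs only
   O(k) in the exponent, because [omega] grows at most like a power [1 / g] with
   [beta <= g] and [m] dominates [omega(Q)]. *)
Lemma absorb_in_weight (omega : R -> R) (g M beta l eta L : R) :
  W0 omega -> 0 < l -> 0 < eta -> 0 <= L -> 0 <= beta <= g -> 0 < g -> 1 <= M ->
  (forall tau y, 0 <= tau ->
     omega (exp (y + tau)) <= M * exp (tau / g) * (omega (exp y) + 1)) ->
  exists (d : nat) (B : R), (0 < d)%nat /\ 0 < B /\ forall (k : nat) (y m : R),
    0 <= y -> 1 <= m -> eta * (omega (exp y) / l) <= m ->
    exp (L * INR k + INR k * y + beta * Rmax 0 (ln (INR k / m)) * INR k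
       - omega (exp y) / l / 2) <= B * weight omega (INR d * l) k.
Proof.
  intros HW Hl He HL Hb Hg HM Hgr.
  pose proof (Rinv_0_lt_compat l Hl) as Pl. pose proof (Rinv_0_lt_compat eta He) as Pe.
  (* [c] is the coefficient of k left over in [Hom]: raising log Q by c gains e^(ck), which cancels
     that term. *)
  set (c := (/ eta + / l) / 2). set (L' := L + c).
  assert (Pc : 0 < c) by (unfold c; lra).
  set (A := M * exp (L' / g)).
  assert (PA : 0 < A) by (unfold A; pose proof (exp_pos (L' / g)); nra).
  (* With d >= 2A, the division by d l brings the bound on omega at the shifted point down to half
     of omega(Q)/l, up to a constant and O(k). This is exactly the decay still available. *)
  destruct (nat_ceil (2 * A) ltac:(lra)) as [d [Hd _]].
  assert (Pd : (0 < d)%nat) by (destruct d; [simpl in Hd; lra | lia]).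
  exists d, (exp (/ l / 2)). repeat split; [exact Pd | apply exp_pos|].
  intros k y m Hy Hm Hmw. pose proof (pos_INR k) as Pk.
  set (S := Rmax 0 (ln (INR k / m))).
  assert (S0 : 0 <= S) by apply Rmax_l.
  set (Om := omega (exp y)) in *.
  assert (POm : 0 <= Om).
  { destruct HW as [[_ [Hpos _]] _]. apply Hpos. left; apply exp_pos. }
  assert (HS : exp S <= 1 + INR k / m).
  { assert (0 <= INR k / m) by (apply Rdiv_le_0_compat; lra).
    unfold S, Rmax. destruct (Rle_dec 0 (ln (INR k / m))) as [Hs|Hs].
    - destruct (Req_dec (INR k / m) 0) as [Hz|Hz].
      + rewrite Hz. unfold ln. case (Rlt_dec 0 0); [intros Hlt; exfalso; lra | intros _].
        rewrite exp_0. lra.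
      + rewrite exp_ln by lra. lra.
    - rewrite exp_0. lra. }
  assert (Pd' : 0 < INR d) by (apply lt_0_INR; auto).
  assert (HSO : exp S * (Om + 1) <= Om + 1 + INR k * (l / eta + 1)).
  { apply Rle_trans with ((1 + INR k / m) * (Om + 1)); [apply Rmult_le_compat_r; lra|].
    assert (Q : (Om + 1) / m <= l / eta + 1).
    { apply Rmult_le_reg_r with m; [lra|].
      replace ((Om + 1) / m * m) with (Om + 1) by (field; lra).
      assert (Om <= l / eta * m).
      { apply Rmult_le_compat_l with (r := l / eta) in Hmw;
          [|left; apply Rdiv_lt_0_compat; auto].
        replace (l / eta * (eta * (Om / l))) with Om in Hmw by (field; lra). exact Hmw. }
      lra. }
    replace ((1 + INR k / m) * (Om + 1)) with (Om + 1 + INR k * ((Om + 1) / m)) by (field; lra).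
    apply Rplus_le_compat_l, Rmult_le_compat_l; auto. }
  assert (Hom : omega (exp (y + (L' + beta * S))) / (INR d * l) <=
     Om / l / 2 + / l / 2 + c * INR k).
  { assert (H1 : omega (exp (y + (L' + beta * S))) <= A * (exp S * (Om + 1))).
    { eapply Rle_trans.
      - apply Hgr. assert (0 <= beta * S) by (apply Rmult_le_pos; lra). unfold L'; lra.
      - fold Om. unfold A.
        replace (M * exp (L' / g) * (exp S * (Om + 1))) with
          (M * (exp (L' / g + S) * (Om + 1))) by (rewrite exp_plus; ring).
        rewrite Rmult_assoc. apply Rmult_le_compat_l; [lra|].
        apply Rmult_le_compat_r; [lra|]. apply exp_le_exp.
        replace ((L' + beta * S) / g) with (L' / g + beta / g * S) by (field; lra).
        assert (beta / g <= 1).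
        { apply Rmult_le_reg_r with g; [lra|].
          replace (beta / g * g) with beta by (field; lra). lra. }
        assert (beta / g * S <= 1 * S) by (apply Rmult_le_compat_r; lra). lra. }
    apply Rmult_le_reg_r with (INR d * l); [apply Rmult_lt_0_compat; auto|].
    replace (omega (exp (y + (L' + beta * S))) / (INR d * l) * (INR d * l))
      with (omega (exp (y + (L' + beta * S)))) by (field; lra).
    eapply Rle_trans; [apply H1|].
    apply Rle_trans with (A * (Om + 1 + INR k * (l / eta + 1)));
      [apply Rmult_le_compat_l; lra|].
    replace ((Om / l / 2 + / l / 2 + c * INR k) * (INR d * l)) with
      (INR d / 2 * (Om + 1 + INR k * (l / eta + 1))) by (unfold c; field; lra).
    apply Rmult_le_compat_r; [|lra].
    assert (0 < l / eta) by (apply Rdiv_lt_0_compat; auto). nra. }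
  eapply Rle_trans; [|apply Rmult_le_compat_l; [left; apply exp_pos|];
    apply (le_weight omega (INR d * l) (y + (L' + beta * S)) k HW)].
  - rewrite <- exp_plus. apply exp_le_exp.
    replace (L * INR k + INR k * y + beta * S * INR k) with
      (INR k * (y + (L' + beta * S)) - c * INR k) by (unfold L'; ring).
    lra.
  - apply Rmult_lt_0_compat; auto.
  - assert (0 <= beta * S) by (apply Rmult_le_pos; lra). unfold L'; lra.
Qed.

(** * Choice of the parameters of the blocks *)

Lemma weight_pos (omega : R -> R) (l : R) (n : nat) : 0 < weight omega l n.
Proof. apply exp_pos. Qed.

(** The enlarged half-width is the midpoint of gamma pi/2 and pi/(2a), so a t stays away from pi/2.
    The margin [eps] is for Cauchy's estimates; the factor 2 before [delta] is the one that
    [gamma_upper_le] halves. *)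
Lemma sector_opening (gamma a : R) :
  0 < gamma -> 0 < a -> a * gamma < 1 ->
  exists eps delta, 0 < eps /\ 0 < delta <= 1 / 2 /\
    forall t, Rabs t <= gamma * PI / 2 + eps -> 2 * delta <= cos (a * t).
Proof.
  intros Hg Ha Hag. pose proof PI_RGT_0 as PP. pose proof (Rinv_0_lt_compat a Ha) as Pa.
  set (eps := (/ a - gamma) * PI / 4).
  assert (Hga : gamma < / a).
  { apply Rmult_lt_reg_l with a; [auto|]. rewrite Rinv_r by lra. exact Hag. }
  assert (Pe : 0 < eps) by (unfold eps; nra).
  set (sigma := gamma * PI / 2 + eps).
  assert (Ps : 0 < sigma) by (unfold sigma; nra).
  assert (Hs : a * sigma < PI / 2).
  { apply Rmult_lt_reg_l with (/ a); [auto|].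
    replace (/ a * (a * sigma)) with sigma by (field; lra). unfold sigma, eps. nra. }
  assert (Hs0 : 0 < a * sigma) by (apply Rmult_lt_0_compat; auto).
  assert (Hc : 0 < cos (a * sigma)) by (apply cos_gt_0; lra).
  exists eps, (cos (a * sigma) / 2). pose proof (COS_bound (a * sigma)).
  split; [exact Pe|]. split; [lra|]. intros t Ht. fold sigma in Ht.
  replace (2 * (cos (a * sigma) / 2)) with (cos (a * sigma)) by field.
  replace (cos (a * t)) with (cos (a * Rabs t)).
  - pose proof (Rabs_pos t). apply cos_decr_1; nra.
  - unfold Rabs. destruct (Rcase_abs t); [|reflexivity].
    replace (a * - t) with (- (a * t)) by ring. apply cos_neg.
Qed.

Lemma exists_blocks (omega : R -> R) (gamma l : R) :
  W0 omega -> 0 < gamma -> Rbar_lt gamma (Rbar_minus (growth_index omega) 1) -> 0 < l ->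
  exists (a : R) (V : nat -> R) (N : nat -> nat) (d : nat) (B : R),
    (0 < d)%nat /\ 0 < B /\ forall (p n k : nat) (w : C),
    (n <= k)%nat -> Rabs (snd w) <= gamma * PI / 2 ->
    weight omega l p / INR (fact p) * Cmod (block_remainder a (V p) p (N p) k n w) <=
      B * (1 / 2) ^ p * weight omega (INR d * l) k * exp ((INR k - INR n) * fst w).
Proof.
  intros HW Hg Hidx Hl.
  destruct (growth_from_index omega gamma HW Hg Hidx) as [g [M [Hgg [HM Hgr]]]].
  (* 1/a is the midpoint of gamma and g - 1. *)
  set (a := 2 / (gamma + g - 1)).
  assert (Ha : 0 < a) by (apply Rdiv_lt_0_compat; lra).
  assert (Ea : / a = (gamma + g - 1) / 2) by (unfold a; field; lra).
  assert (Hag : a * gamma < 1).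
  { apply Rmult_lt_reg_l with (/ a); [apply Rinv_0_lt_compat; auto|].
    replace (/ a * (a * gamma)) with gamma by (field; lra). lra. }
  destruct (sector_opening gamma a Hg Ha Hag) as [eps [delta [He [Hd Hcos]]]].
  destruct (block_weighted_bound a _ delta Ha Hd Hcos) as [eta [L [Heta [HL Hblock]]]].
  (* The added 1 gives D >= 1, so that the Cauchy factor (4e/eps)^n is at most D^k for n <= k.
     Together with e^(k eps) it costs e^(k L1). *)
  set (D := 1 + 4 * exp 1 / eps).
  assert (PD : 0 < 4 * exp 1 / eps).
  { apply Rdiv_lt_0_compat; [pose proof (exp_pos 1); lra | auto]. }
  assert (PlD : 0 <= ln D).
  { rewrite <- ln_1. apply ln_le; unfold D; lra. }
  set (L1 := ln D + eps).
  destruct (absorb_in_weight omega g M (1 + / a) l eta (L + L1) HW Hl) as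
    [d [B [Pd [PB Habs]]]]; try (unfold L1; lra).
  { exact Hgr. }
  assert (Hpar : forall p, exists yN : R * nat,
    let m := INR p + 1 + eta * (omega (exp (fst yN)) / l) in
    0 <= fst yN /\ weight omega l p <= exp (1 + INR p * fst yN - omega (exp (fst yN)) / l) /\
    m <= a * INR (snd yN) /\ INR (snd yN) <= m / a + 1 /\
    0 <= omega (exp (fst yN)) / l).
  { intros p. destruct (weight_le omega l p HW Hl) as [y [Hy Hwy]].
    assert (PO : 0 <= omega (exp y) / l).
    { apply Rdiv_le_0_compat; [|exact Hl].
      destruct HW as [[_ [Hpos _]] _]. apply Hpos. left; apply exp_pos. }
    set (m := INR p + 1 + eta * (omega (exp y) / l)).
    assert (Pm : 0 <= m).
    { pose proof (pos_INR p). unfold m.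
      assert (0 <= eta * (omega (exp y) / l)) by (apply Rmult_le_pos; lra). lra. }
    destruct (nat_ceil (m / a)) as [N [HN1 HN2]]; [apply Rdiv_le_0_compat; auto|].
    exists (y, N); simpl. fold m. repeat split; auto.
    apply Rmult_le_compat_l with (r := a) in HN1; [|lra].
    replace (a * (m / a)) with m in HN1 by (field; lra). exact HN1. }
  (* The near-maximisers and cutoff orders are fixed for all p at once, before any sequence is
     given. *)
  apply functional_choice in Hpar. destruct Hpar as [yN HyN].
  set (y := fun p => fst (yN p)).
  set (m := fun p => INR p + 1 + eta * (omega (exp (y p)) / l)).
  exists a, (fun p => m p * exp (a * (ln eta + ln (m p) - y p))), (fun p => snd (yN p)),
    d, (exp L * B).
  split; [exact Pd|]. split; [apply Rmult_lt_0_compat; [apply exp_pos | exact PB]|].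
  intros p n k w Hnk Hw.
  destruct (HyN p) as [Hy [HWy [HN1 [HN2 PO]]]]. fold (y p) in *. fold (m p) in *.
  set (W := weight omega l p) in *. assert (PW : 0 < W) by apply weight_pos.
  set (Om := omega (exp (y p)) / l) in *.
  pose proof (INR_fact_lt_0 p) as Fp. pose proof (INR_fact_lt_0 k) as Fk.
  set (E := L + L * INR k - INR p * ln 2 + INR k * y p
      + (1 + / a) * Rmax 0 (ln (INR k / m p)) * INR k - Om / 2).
  set (U := block_remainder a (m p * exp (a * (ln eta + ln (m p) - y p))) p (snd (yN p)) k).
  assert (PWf : 0 < W / INR (fact p)) by (apply Rdiv_lt_0_compat; auto).
  (* Cauchy's estimate applies to the remainder alone, so the factor W/p! is divided out here and
     restored afterwards. *)
  set (M0 := exp E / INR (fact k) / (W / INR (fact p))).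
  assert (PM0 : 0 <= M0).
  { unfold M0. apply Rdiv_le_0_compat; [|exact PWf].
    apply Rdiv_le_0_compat; [left; apply exp_pos | exact Fk]. }
  assert (HU : Cmod (U n w) <= M0 * (4 * exp 1 / eps) ^ n * INR (fact n) *
     exp (INR k * eps) * exp ((INR k - INR n) * fst w)).
  { apply (derivative_chain_cauchy U (gamma * PI / 2 + eps)); auto.
    - apply block_remainder_chain.
    - intros z Hz. apply Rmult_le_reg_l with (W / INR (fact p)); [exact PWf|].
      replace (W / INR (fact p) * (M0 * exp (INR k * fst z))) with
        (exp E / INR (fact k) * exp (INR k * fst z)) by (unfold M0; field; lra).
      apply Hblock; auto. lra.
    - lra. }
  assert (Pm : 1 <= m p).
  { pose proof (pos_INR p). unfold m. fold Om.
    assert (0 <= eta * Om) by (apply Rmult_le_pos; lra). lra. }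
  pose proof (Habs k (y p) (m p) Hy Pm) as HB.
  fold Om in HB. specialize (HB ltac:(unfold m; fold Om; pose proof (pos_INR p); lra)).
  apply Rle_trans with (W / INR (fact p) * (M0 * (4 * exp 1 / eps) ^ n * INR (fact n) *
     exp (INR k * eps) * exp ((INR k - INR n) * fst w))).
  { apply Rmult_le_compat_l; [lra | exact HU]. }
  replace (W / INR (fact p) * (M0 * (4 * exp 1 / eps) ^ n * INR (fact n) *
     exp (INR k * eps) * exp ((INR k - INR n) * fst w))) with
    (exp E * ((4 * exp 1 / eps) ^ n * (INR (fact n) / INR (fact k))) *
      exp (INR k * eps) * exp ((INR k - INR n) * fst w)).
  2:{ unfold M0. generalize ((4 * exp 1 / eps) ^ n). intros. field. lra. }
  apply Rmult_le_compat_r; [left; apply exp_pos|].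
  assert (HD : (4 * exp 1 / eps) ^ n * (INR (fact n) / INR (fact k)) <= exp (INR k * ln D)).
  { rewrite <- exp_INR_ln by (unfold D; lra). rewrite <- (Rmult_1_r (D ^ k)).
    apply Rmult_le_compat.
    - apply pow_le; lra.
    - apply Rdiv_le_0_compat; [apply pos_INR | exact Fk].
    - apply Rle_trans with (D ^ n); [apply pow_incr; unfold D; lra|].
      apply Rle_pow; [unfold D; lra | exact Hnk].
    - apply Rmult_le_reg_r with (INR (fact k)); [exact Fk|].
      replace (INR (fact n) / INR (fact k) * INR (fact k)) with (INR (fact n)) by (field; lra).
      rewrite Rmult_1_l. apply le_INR, fact_le, Hnk. }
  apply Rle_trans with (exp E * exp (INR k * ln D) * exp (INR k * eps)).
  { apply Rmult_le_compat_r; [left; apply exp_pos|].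
    apply Rmult_le_compat_l; [left; apply exp_pos | exact HD]. }
  replace ((1 / 2) ^ p) with (exp (- (INR p * ln 2))).
  2:{ rewrite exp_Ropp, exp_mult_INR, exp_ln by lra. unfold Rdiv.
      rewrite Rmult_1_l. apply eq_sym, pow_inv. }
  replace (exp L * B * exp (- (INR p * ln 2)) * weight omega (INR d * l) k) with
    (exp (L - INR p * ln 2) * (B * weight omega (INR d * l) k))
    by (unfold Rminus; rewrite exp_plus; ring).
  rewrite <- !exp_plus.
  eapply Rle_trans; [|apply Rmult_le_compat_l; [left; apply exp_pos | exact HB]].
  rewrite <- exp_plus. apply exp_le_exp. unfold E, L1. lra.
Qed.

(** * Series of building blocks *)

Definition CSeries (u : nat -> C) : C :=
  (Series (fun p => fst (u p)), Series (fun p => snd (u p))).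

Definition geom_bounded (K : R) (u : nat -> C) : Prop :=
  forall p, Cmod (u p) <= K * (1 / 2) ^ p.

Lemma ex_series_half (K : R) : ex_series (fun p => K * (1 / 2) ^ p).
Proof.
  apply (ex_series_scal (V := R_NormedModule)), ex_series_geom.
  rewrite Rabs_pos_eq; lra.
Qed.

Lemma geom_bounded_real (K : R) (u : nat -> R) :
  (forall p, Rabs (u p) <= K * (1 / 2) ^ p) ->
  ex_series u /\ Rabs (Series u) <= 2 * K.
Proof.
  intros H. assert (E : ex_series (fun p => Rabs (u p))).
  { apply (ex_series_le (V := R_CompleteNormedModule) _ (fun p => K * (1 / 2) ^ p)).
    - intros p. change (Rabs (Rabs (u p)) <= K * (1 / 2) ^ p). rewrite Rabs_Rabsolu. apply H.
    - apply ex_series_half. }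
  split; [apply ex_series_Rabs, E|].
  eapply Rle_trans; [apply Series_Rabs, E|].
  eapply Rle_trans; [apply (Series_le _ (fun p => K * (1 / 2) ^ p))|].
  - intros p; split; [apply Rabs_pos | apply H].
  - apply ex_series_half.
  - rewrite Series_scal_l, Series_geom by (rewrite Rabs_pos_eq; lra). lra.
Qed.

Lemma geom_bounded_components (K : R) (u : nat -> C) : geom_bounded K u ->
  (ex_series (fun p => fst (u p)) /\ Rabs (Series (fun p => fst (u p))) <= 2 * K) /\
  (ex_series (fun p => snd (u p)) /\ Rabs (Series (fun p => snd (u p))) <= 2 * K).
Proof.
  intros H. split; apply geom_bounded_real; intros p; (eapply Rle_trans; [|apply H]).
  - apply Rabs_fst_le_Cmod.
  - apply Rabs_snd_le_Cmod.
Qed.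

(** The constant 4 is 2 from the geometric sum times 2 from the two components. *)
Lemma Cmod_CSeries_le (K : R) (u : nat -> C) :
  geom_bounded K u -> Cmod (CSeries u) <= 4 * K.
Proof.
  intros H. destruct (geom_bounded_components K u H) as [[_ H1] [_ H2]].
  eapply Rle_trans; [apply Cmod_le_Rabs|]. simpl. lra.
Qed.

Lemma CSeries_ext (u v : nat -> C) : (forall p, u p = v p) -> CSeries u = CSeries v.
Proof.
  intros H. unfold CSeries. f_equal; apply Series_ext; intros p; rewrite H; reflexivity.
Qed.

Lemma CSeries_lin (c : C) (u v : nat -> C) (K L : R) :
  geom_bounded K u -> geom_bounded L v ->
  CSeries (fun p => c * u p + v p)%C = (c * CSeries u + CSeries v)%C.
Proof.
  intros Hu Hv.
  destruct (geom_bounded_components K u Hu) as [[U1 _] [U2 _]].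
  destruct (geom_bounded_components L v Hv) as [[V1 _] [V2 _]].
  assert (S : forall (a b : R) (f g h : nat -> R), ex_series f -> ex_series g -> ex_series h ->
    Series (fun p => a * f p + b * g p + h p) = a * Series f + b * Series g + Series h).
  { intros a b f g h Hf Hg Hh.
    assert (Ef : ex_series (fun p => a * f p)) by (apply (ex_series_scal (V := R_NormedModule)), Hf).
    assert (Eg : ex_series (fun p => b * g p)) by (apply (ex_series_scal (V := R_NormedModule)), Hg).
    rewrite Series_plus, Series_plus, !Series_scal_l; auto.
    apply (ex_series_plus (V := R_NormedModule)); auto. }
  unfold CSeries, Cplus, Cmult; simpl. f_equal.
  - rewrite (Series_ext _ (fun p => fst c * fst (u p) + - snd c * snd (u p) + fst (v p)))
      by (intros p; ring).
    rewrite S by auto. ring.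
  - rewrite S by auto. ring.
Qed.

Lemma Series_single (n : nat) (c : R) : Series (fun p => if Nat.eqb p n then c else 0) = c.
Proof.
  apply is_series_unique. induction n as [|n IH].
  - apply is_series_decr_1. simpl.
    apply is_series_Reals. intros eps He. exists O. intros k _.
    rewrite sum_eq_R0; [|reflexivity]. unfold Rdist.
    unfold plus, opp; simpl. replace (0 - (c + - c)) with 0 by ring.
    rewrite Rabs_R0. exact He.
  - apply is_series_decr_1. simpl.
    unfold plus, opp; simpl. replace (c + - 0) with c by ring. exact IH.
Qed.

Lemma CSeries_single (n : nat) (c : C) :
  CSeries (fun p => if Nat.eqb p n then c else 0%C) = c.
Proof.
  unfold CSeries. destruct c as [x y]. f_equal.
  - etransitivity; [|apply (Series_single n x)]. apply Series_ext. intros p.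
    destruct (Nat.eqb p n); reflexivity.
  - etransitivity; [|apply (Series_single n y)]. apply Series_ext. intros p.
    destruct (Nat.eqb p n); reflexivity.
Qed.

(** * Taylor bounds, and passage from the w-plane to the surface *)

Lemma Cmod_increment_le (g g1 : C -> C) (w h : C) (M : R) :
  (forall z, is_cderive g z (g1 z)) ->
  (forall t : R, 0 <= t <= 1 -> Cmod (g1 (w + t * h)%C) <= M) ->
  Cmod (g (w + h) - g w)%C <= 2 * M * Cmod h.
Proof.
  intros Hg HM. destruct w as [x y]. destruct h as [u v].
  assert (HD : forall t : R,
    is_derive (fun t => fst (g (x + t * u, y + t * v))) t
      (fst (g1 (x + t * u, y + t * v)%R * (u, v))%C) /\
    is_derive (fun t => snd (g (x + t * u, y + t * v))) t
      (snd (g1 (x + t * u, y + t * v)%R * (u, v))%C)).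
  { intros t.
    apply (is_cderive_real_path g (fun t => x + t * u) (fun t => y + t * v) t u v);
      [auto_derive; [trivial | ring] .. | apply Hg]. }
  assert (HK : forall t : R, 0 <= t <= 1 ->
     Cmod (g1 (x + t * u, y + t * v)%R * (u, v))%C <= M * Cmod (u, v)).
  { intros t Ht. rewrite Cmod_mult. apply Rmult_le_compat_r; [apply Cmod_ge_0|].
    specialize (HM t Ht).
    replace ((x, y) + t * (u, v))%C with ((x + t * u, y + t * v) : C) in HM
      by (unfold Cplus, Cmult; simpl; f_equal; ring). exact HM. }
  assert (HB : forall f df : R -> R, (forall t, is_derive f t (df t)) ->
     (forall t, 0 <= t <= 1 -> Rabs (df t) <= M * Cmod (u, v)) ->
     Rabs (f 1 - f 0) <= M * Cmod (u, v)).
  { intros f df H1 H2. destruct (MVT_gen f 0 1 df) as [c [Hc E]].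
    - intros t _. apply H1.
    - intros t _. apply derivable_continuous_pt. exists (df t). apply is_derive_Reals, H1.
    - rewrite Rmin_left, Rmax_right in Hc by lra. rewrite E.
      replace (df c * (1 - 0)) with (df c) by ring. auto. }
  pose proof (HB _ _ (fun t => proj1 (HD t))
    (fun t Ht => Rle_trans _ _ _ (Rabs_fst_le_Cmod _) (HK t Ht))) as B1.
  pose proof (HB _ _ (fun t => proj2 (HD t))
    (fun t Ht => Rle_trans _ _ _ (Rabs_snd_le_Cmod _) (HK t Ht))) as B2.
  cbv beta in B1, B2.
  replace (x + 1 * u, y + 1 * v) with (Cplus (x, y) (u, v)) in B1, B2
    by (unfold Cplus; simpl; f_equal; ring).
  replace (x + 0 * u, y + 0 * v) with (x, y) in B1, B2 by (f_equal; ring).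
  eapply Rle_trans; [apply Cmod_le_Rabs|].
  revert B1 B2. generalize (g (Cplus (x, y) (u, v))) (g (x, y)). intros A B B1 B2.
  unfold Cminus, Cplus, Copp; simpl. unfold Rminus in *. lra.
Qed.

(** The increment bound is applied to z -> g(z) - g1(w) z, whose derivative g1(z) - g1(w) is bounded
    by the same lemma. An explicit remainder is what allows termwise differentiation of a series. *)
Lemma Cmod_taylor_le (g g1 g2 : C -> C) (w h : C) (M : R) :
  (forall z, is_cderive g z (g1 z)) -> (forall z, is_cderive g1 z (g2 z)) ->
  (forall t : R, 0 <= t <= 1 -> Cmod (g2 (w + t * h)%C) <= M) ->
  Cmod (g (w + h) - g w - g1 w * h)%C <= 4 * M * (Cmod h * Cmod h).
Proof.
  intros Hg Hg1 HM.
  assert (PM : 0 <= M).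
  { eapply Rle_trans; [apply Cmod_ge_0 | apply (HM 0); lra]. }
  pose proof (Cmod_ge_0 h) as Ph.
  replace (g (w + h) - g w - g1 w * h)%C with
    ((g (w + h) + - g1 w * (w + h)) - (g w + - g1 w * w))%C by ring.
  replace (4 * M * (Cmod h * Cmod h)) with (2 * (2 * M * Cmod h) * Cmod h) by ring.
  apply (Cmod_increment_le (fun z => g z + - g1 w * z)%C (fun z => g1 z + - g1 w * 1)%C).
  - intros z. apply is_cderive_plus; [apply Hg|]. apply is_cderive_scal, is_cderive_id.
  - intros t Ht. replace (g1 (w + t * h) + - g1 w * 1)%C with (g1 (w + t * h) - g1 w)%C by ring.
    assert (E : Cmod (t * h)%C <= Cmod h).
    { rewrite Cmod_mult, Cmod_R, Rabs_pos_eq by lra. nra. }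
    eapply Rle_trans; [apply (Cmod_increment_le g1 g2 w (t * h)%C M Hg1)|].
    + intros s Hs. replace (w + s * (t * h))%C with (w + (s * t)%R * h)%C
        by (rewrite RtoC_mult; ring). apply HM. nra.
    + apply Rmult_le_compat_l; lra.
Qed.

(** A point of [RLog] is the pair of coordinates of log z, so [rl_proj] is convertible with [cexp].
    The derivative in z is then the quotient of the w-derivatives of f and of [cexp], the latter
    never 0. Agreement near z suffices, as f is arbitrary off the sector. *)
Lemma is_rl_derive_cderive (f : RLog -> C) (g : C -> C) (z : C) (d : C) (r : R) :
  0 < r -> (forall h, Cmod h < r -> f (z + h)%C = g (z + h)%C) ->
  is_cderive g z (cexp z * d) -> is_rl_derive f z d.
Proof.
  intros Hr Hfg Hg. unfold is_rl_derive. apply filterlim_locally. intros [eps He].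
  set (A := Cmod (cexp z)).
  assert (PA : 0 < A) by (unfold A; rewrite Cmod_cexp; apply exp_pos).
  pose proof (Cmod_ge_0 d) as Pd.
  destruct (Hg (eps * A / 8)) as [d1 [P1 H1]]; [nra|].
  (* The first bound keeps |D| >= (A/2)|h|, so the quotient is defined; the second controls the
     error d Y. *)
  set (e2 := Rmin (A / 2) (eps * A / 8 / (Cmod d + 1))).
  assert (Pe2 : 0 < e2).
  { apply Rmin_pos; [lra|]. apply Rdiv_lt_0_compat; nra. }
  destruct (is_cderive_cexp z e2 Pe2) as [d2 [P2 H2]].
  set (de := Rmin r (Rmin d1 d2)).
  assert (Pde : 0 < de / 2) by (assert (0 < de) by (repeat apply Rmin_pos; auto); lra).
  exists (mkposreal _ Pde). intros w Hw Hne. change C in w.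
  set (h := (w - z)%C).
  assert (Ew : w = (z + h)%C) by (unfold h; ring).
  assert (Hh : Cmod h < de).
  { destruct Hw as [B1 B2]. change (Rabs (fst w - fst z) < de / 2) in B1.
    change (Rabs (snd w - snd z) < de / 2) in B2.
    eapply Rle_lt_trans; [apply Cmod_le_Rabs|].
    unfold h; simpl. unfold Rminus in *. lra. }
  assert (L1 : de <= r) by apply Rmin_l.
  assert (L2 : de <= d1) by (eapply Rle_trans; [apply Rmin_r | apply Rmin_l]).
  assert (L3 : de <= d2) by (eapply Rle_trans; [apply Rmin_r | apply Rmin_r]).
  assert (Ph : 0 < Cmod h).
  { apply Cmod_gt_0. intros E. apply Hne. rewrite Ew, E. apply Cplus_0_r. }
  specialize (H1 h ltac:(lra)). specialize (H2 h ltac:(lra)).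
  rewrite <- (Hfg h ltac:(lra)) in H1.
  assert (Ez : f z = g z).
  { replace z with (z + 0)%C by ring. apply Hfg. rewrite Cmod_0. exact Hr. }
  rewrite <- Ez in H1. rewrite <- Ew in H1, H2.
  change (rl_proj w) with (cexp w). change (rl_proj z) with (cexp z).
  set (D := (cexp w - cexp z)%C) in *.
  set (X := (f w - f z - cexp z * d * h)%C) in *.
  set (Y := (D - cexp z * h)%C) in *.
  assert (e2a : e2 <= A / 2) by apply Rmin_l.
  assert (e2b : e2 <= eps * A / 8 / (Cmod d + 1)) by apply Rmin_r.
  assert (HD : A / 2 * Cmod h <= Cmod D).
  { assert (T : Cmod (cexp z * h)%C <= Cmod D + Cmod Y).
    { replace (cexp z * h)%C with (D + - Y)%C by (unfold Y; ring).
      eapply Rle_trans; [apply Cmod_triangle|]. rewrite Cmod_opp. lra. }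
    rewrite Cmod_mult in T. fold A in T. nra. }
  assert (PD : 0 < Cmod D) by nra.
  assert (ND : D <> 0%C) by (intros E; rewrite E, Cmod_0 in PD; lra).
  assert (HQ : Cmod ((f w - f z) / D - d)%C < eps).
  { replace ((f w - f z) / D - d)%C with ((X - d * Y) / D)%C
      by (unfold X, Y; field; exact ND).
    unfold Cdiv. rewrite Cmod_mult, Cmod_inv by exact ND.
    apply Rmult_lt_reg_r with (Cmod D); [exact PD|].
    rewrite Rmult_assoc, Rinv_l, Rmult_1_r by lra.
    assert (T1 : Cmod (X - d * Y)%C <= Cmod X + Cmod d * Cmod Y).
    { unfold Cminus. eapply Rle_trans; [apply Cmod_triangle|].
      rewrite Cmod_opp, Cmod_mult. lra. }
    assert (T2 : Cmod d * Cmod Y <= eps * A / 8 * Cmod h).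
    { apply Rle_trans with ((Cmod d + 1) * (eps * A / 8 / (Cmod d + 1) * Cmod h)).
      - apply Rmult_le_compat; try apply Cmod_ge_0; try lra.
        eapply Rle_trans; [apply H2|]. apply Rmult_le_compat_r; lra.
      - apply Req_le. field. lra. }
    assert (T3 : eps * (A / 2 * Cmod h) <= eps * Cmod D) by (apply Rmult_le_compat_l; lra).
    assert (T4 : 0 < eps * A * Cmod h) by (repeat apply Rmult_lt_0_compat; auto).
    lra. }
  split.
  - eapply Rle_lt_trans; [|exact HQ]. eapply Rle_trans; [|apply Rabs_fst_le_Cmod].
    apply Req_le. reflexivity.
  - eapply Rle_lt_trans; [|exact HQ]. eapply Rle_trans; [|apply Rabs_snd_le_Cmod].
    apply Req_le. reflexivity.
Qed.

Lemma rl_derive_unique (f : RLog -> C) (z : RLog) (d : C) :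
  is_rl_derive f z d -> rl_derive f z = d.
Proof.
  (* Uniqueness of the limit behind [iota] needs punctured neighbourhoods to be nonempty; a shift of
     the first coordinate supplies a point. *)
  intros H. assert (PF : ProperFilter' (locally' z)).
  { constructor; [|apply _]. intros [[de Hde] HF]. destruct z as [x t].
    apply (HF (x + de / 2, t)).
    - split; [|apply ball_center]. change (Rabs (x + de / 2 - x) < de).
      replace (x + de / 2 - x) with (de / 2) by ring. rewrite Rabs_pos_eq; lra.
    - intros E. injection E. lra. }
  exact (iota_filterlim_locally (V := C_R_CompleteNormedModule) _ _ H).
Qed.

(** * Formal power series with z^p replaced by a block *)

Definition borel_sum (b : nat -> nat -> C -> C) (alpha : nat -> C) (n : nat) (w : C) : C :=
  CSeries (fun p => alpha p / INR (fact p) * b p n w)%C.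

(* [b p n] is the [n]-th derivative of [b p 0], a perturbation of [z^p]. *)
Definition admissible_blocks (s B : R) (wt W : nat -> R) (b : nat -> nat -> C -> C) : Prop :=
  (forall p, derivative_chain (b p)) /\
  (forall p n w, Rabs (snd w) <= s ->
     wt p / INR (fact p) * Cmod (b p n w) <= B * (1 / 2) ^ p * W n) /\
  (forall p n w, Rabs (snd w) <= s ->
     wt p / INR (fact p) * Cmod (b p n w - (if Nat.eqb p n then INR (fact n) else 0))%C
       <= B * (1 / 2) ^ p * W (S n) * exp (fst w)).

Lemma coefficient_bound (A : R) (wt : nat -> R) (alpha : nat -> C) (p : nat) (x : C) (K : R) :
  0 <= A -> Cmod (alpha p) <= A * wt p -> wt p / INR (fact p) * Cmod x <= K ->
  Cmod (alpha p / INR (fact p) * x)%C <= A * K.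
Proof.
  intros HA Ha HK. unfold Cdiv.
  rewrite !Cmod_mult, Cmod_inv, Cmod_R by apply RtoC_fact_neq_0.
  pose proof (INR_fact_lt_0 p) as F. rewrite Rabs_pos_eq by lra.
  apply Rle_trans with (A * (wt p / INR (fact p) * Cmod x)).
  - replace (A * (wt p / INR (fact p) * Cmod x)) with
      (A * wt p * / INR (fact p) * Cmod x) by (unfold Rdiv; ring).
    apply Rmult_le_compat_r; [apply Cmod_ge_0|].
    apply Rmult_le_compat_r; [left; apply Rinv_0_lt_compat; auto | exact Ha].
  - apply Rmult_le_compat_l; auto.
Qed.

Lemma borel_sum_geom (s B A : R) (wt W : nat -> R) b alpha n w :
  admissible_blocks s B wt W b -> 0 <= A ->
  (forall p, Cmod (alpha p) <= A * wt p) -> Rabs (snd w) <= s ->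
  geom_bounded (A * (B * W n)) (fun p => alpha p / INR (fact p) * b p n w)%C.
Proof.
  intros [_ [H _]] HA Ha Hw p.
  replace (A * (B * W n) * (1 / 2) ^ p) with (A * (B * (1 / 2) ^ p * W n)) by ring.
  apply coefficient_bound with wt; auto.
Qed.

Lemma Cmod_borel_sum_le (s B A : R) (wt W : nat -> R) b alpha n w :
  admissible_blocks s B wt W b -> 0 <= A ->
  (forall p, Cmod (alpha p) <= A * wt p) -> Rabs (snd w) <= s ->
  Cmod (borel_sum b alpha n w) <= 4 * (A * (B * W n)).
Proof. intros. eapply Cmod_CSeries_le, borel_sum_geom; eauto. Qed.

Lemma borel_sum_lin (s B A A' : R) (wt W : nat -> R) b (c : C) alpha beta n w :
  admissible_blocks s B wt W b -> 0 <= A -> 0 <= A' ->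
  (forall p, Cmod (alpha p) <= A * wt p) -> (forall p, Cmod (beta p) <= A' * wt p) ->
  Rabs (snd w) <= s ->
  borel_sum b (fun p => c * alpha p + beta p)%C n w =
    (c * borel_sum b alpha n w + borel_sum b beta n w)%C.
Proof.
  intros Hb HA HA' Ha Ha' Hw. unfold borel_sum.
  rewrite <- (CSeries_lin c _ _ _ _ (borel_sum_geom _ _ _ _ _ _ _ n w Hb HA Ha Hw)
    (borel_sum_geom _ _ _ _ _ _ _ n w Hb HA' Ha' Hw)).
  apply CSeries_ext. intros p. field. apply RtoC_fact_neq_0.
Qed.

(** The term alpha_n is itself a series with one nonzero term, so the subtraction is done termwise;
    the third clause of [admissible_blocks] then gives a bound of order |z|. *)
Lemma borel_sum_limit (s B A : R) (wt W : nat -> R) b alpha n w :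
  admissible_blocks s B wt W b -> 0 <= A ->
  (forall p, Cmod (alpha p) <= A * wt p) -> Rabs (snd w) <= s ->
  Cmod (borel_sum b alpha n w - alpha n)%C <= 4 * (A * (B * W (S n) * exp (fst w))).
Proof.
  intros Hb HA Ha Hw.
  set (e := fun p => if Nat.eqb p n then alpha n else 0%C).
  set (u := fun p => (alpha p / INR (fact p) *
    (b p n w - (if Nat.eqb p n then INR (fact n) else 0)))%C).
  assert (Hu : geom_bounded (A * (B * W (S n) * exp (fst w))) u).
  { intros p. replace (A * (B * W (S n) * exp (fst w)) * (1 / 2) ^ p) with
      (A * (B * (1 / 2) ^ p * W (S n) * exp (fst w))) by ring.
    apply coefficient_bound with wt; auto. apply Hb, Hw. }
  replace (borel_sum b alpha n w - alpha n)%C with (CSeries u);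
    [apply Cmod_CSeries_le, Hu|].
  assert (E : CSeries u = (-1 * CSeries e + borel_sum b alpha n w)%C).
  { unfold borel_sum.
    (* The one-term series is geometrically bounded with constant 2^n |alpha_n|. *)
    rewrite <- (CSeries_lin (-1)%C e _ (Cmod (alpha n) * 2 ^ n) (A * (B * W n))).
    - apply CSeries_ext. intros p. unfold u, e.
      destruct (Nat.eqb_spec p n) as [->|_]; field; apply RtoC_fact_neq_0.
    - intros p. unfold e. destruct (Nat.eqb_spec p n) as [->|_].
      + rewrite Rmult_assoc, <- Rpow_mult_distr. replace (2 * (1 / 2)) with 1 by field.
        rewrite pow1. lra.
      + rewrite Cmod_0. repeat apply Rmult_le_pos; try apply Cmod_ge_0; apply pow_le; lra.
    - eapply borel_sum_geom; eauto. }
  rewrite E. unfold e. rewrite CSeries_single. ring.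
Qed.

(** Termwise differentiation: the Taylor remainder of the p-th term is O(2^(-p) |h|^2), uniformly
    near w, by the bounds on the derivatives of orders n + 1 and n + 2. *)
Lemma is_cderive_borel_sum (s B A : R) (wt W : nat -> R) b alpha n w :
  admissible_blocks s B wt W b -> 0 <= A ->
  (forall p, Cmod (alpha p) <= A * wt p) -> Rabs (snd w) < s ->
  is_cderive (borel_sum b alpha n) w (cexp w * borel_sum b alpha (S n) w).
Proof.
  intros Hb HA Ha Hw eps He.
  pose proof (fun n w => borel_sum_geom s B A wt W b alpha n w Hb HA Ha) as HG.
  assert (PW : forall n, 0 <= A * (B * W n)).
  { intros k. specialize (HG k w ltac:(lra) O). simpl in HG. rewrite Rmult_1_r in HG.
    eapply Rle_trans; [apply Cmod_ge_0 | exact HG]. }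
  (* [e] bounds |e^z| on the unit disc around w, and [K], up to 2^(-p), the second w-derivative of
     each term, since d/dw = e^w d/dz. *)
  set (e := exp (fst w + 1)). assert (Pe : 0 < e) by apply exp_pos.
  set (K := e * (A * (B * W (S n))) + e * (e * (A * (B * W (S (S n)))))).
  assert (PK : 0 <= K).
  { unfold K. assert (0 <= e * (A * (B * W (S (S n))))) by (apply Rmult_le_pos; [lra | auto]).
    assert (0 <= e * (A * (B * W (S n)))) by (apply Rmult_le_pos; [lra | auto]). nra. }
  assert (PD : 0 < eps / (16 * K + 1)) by (apply Rdiv_lt_0_compat; lra).
  (* 16 is 4 from the Taylor bound times 4 from the summation; the other bounds keep the segment in
     the unit disc and in the strip. *)
  exists (Rmin (Rmin 1 (s - Rabs (snd w))) (eps / (16 * K + 1))).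
  split; [repeat apply Rmin_pos; lra|]. intros h Hh.
  assert (Hh1 : Cmod h < 1).
  { eapply Rlt_le_trans; [exact Hh|]. eapply Rle_trans; apply Rmin_l. }
  assert (Hh2 : Cmod h < s - Rabs (snd w)).
  { eapply Rlt_le_trans; [exact Hh|]. eapply Rle_trans; [apply Rmin_l | apply Rmin_r]. }
  assert (Hh3 : Cmod h < eps / (16 * K + 1)).
  { eapply Rlt_le_trans; [exact Hh | apply Rmin_r]. }
  pose proof (Cmod_ge_0 h) as Ph.
  assert (Hseg : forall t : R, 0 <= t <= 1 -> Rabs (snd (w + t * h)%C) <= s /\
     Cmod (cexp (w + t * h)) <= e).
  { intros t Ht. pose proof (Rabs_fst_le_Cmod h) as F1. pose proof (Rabs_snd_le_Cmod h) as F2.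
    split.
    - simpl. eapply Rle_trans; [apply Rabs_triang|].
      replace (t * snd h + 0 * fst h) with (t * snd h) by ring.
      rewrite Rabs_mult, (Rabs_pos_eq t) by lra.
      assert (t * Rabs (snd h) <= 1 * Cmod h)
        by (apply Rmult_le_compat; try apply Rabs_pos; lra). lra.
    - rewrite Cmod_cexp. unfold e. apply exp_le_exp. simpl.
      replace (t * fst h - 0 * snd h) with (t * fst h) by ring.
      assert (t * Rabs (fst h) <= 1 * Cmod h)
        by (apply Rmult_le_compat; try apply Rabs_pos; lra).
      assert (t * fst h <= t * Rabs (fst h)) by (apply Rmult_le_compat_l; [lra | apply Rle_abs]).
      lra. }
  assert (Hh0 : Rabs (snd (w + h)%C) <= s).
  { replace h with (1 * h)%C by ring. apply Hseg. lra. }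
  assert (E : (borel_sum b alpha n (w + h) - borel_sum b alpha n w
      - cexp w * borel_sum b alpha (S n) w * h)%C =
    CSeries (fun p => - (cexp w * h) * (alpha p / INR (fact p) * b p (S n) w) +
      (-1 * (alpha p / INR (fact p) * b p n w) + alpha p / INR (fact p) * b p n (w + h)))%C).
  { assert (Hw' : Rabs (snd w) <= s) by lra.
    pose proof (CSeries_lin (-1)%C _ _ _ _ (HG n w Hw') (HG n _ Hh0)) as E1.
    erewrite CSeries_lin.
    - rewrite E1. unfold borel_sum. ring.
    - apply (HG (S n) w Hw').
    - instantiate (1 := A * (B * W n) + A * (B * W n)). intros p.
      eapply Rle_trans; [apply Cmod_triangle|]. rewrite Rmult_plus_distr_r.
      apply Rplus_le_compat; [|apply (HG n _ Hh0)].
      replace (-1 * (alpha p / INR (fact p) * b p n w))%C with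
        (- (alpha p / INR (fact p) * b p n w))%C by ring.
      rewrite Cmod_opp. apply (HG n w Hw'). }
  rewrite E.
  apply Rle_trans with (4 * (4 * K * (Cmod h * Cmod h))).
  - apply Cmod_CSeries_le. intros p.
    set (c := (alpha p / INR (fact p))%C).
    replace (- (cexp w * h) * (c * b p (S n) w) + (-1 * (c * b p n w) + c * b p n (w + h)))%C
      with (c * b p n (w + h) - c * b p n w - c * (cexp w * b p (S n) w) * h)%C by ring.
    replace (4 * K * (Cmod h * Cmod h) * (1 / 2) ^ p) with
      (4 * (K * (1 / 2) ^ p) * (Cmod h * Cmod h)) by ring.
    destruct Hb as [Hch Hb].
    apply (Cmod_taylor_le (fun z => c * b p n z)%C
      (fun z => c * (cexp z * b p (S n) z))%C
      (fun z => c * (cexp z * b p (S n) z + cexp z * (cexp z * b p (S (S n)) z)))%C).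
    + intros z. apply is_cderive_scal, Hch.
    + intros z. apply is_cderive_scal, derivative_chain_second, Hch.
    + intros t Ht. destruct (Hseg t Ht) as [S1 S2].
      set (z := (w + t * h)%C) in *.
      replace (c * (cexp z * b p (S n) z + cexp z * (cexp z * b p (S (S n)) z)))%C with
        (cexp z * (c * b p (S n) z) + cexp z * (cexp z * (c * b p (S (S n)) z)))%C by ring.
      eapply Rle_trans; [apply Cmod_triangle|]. rewrite !Cmod_mult.
      unfold K. rewrite Rmult_plus_distr_r, <- !(Cmod_mult c).
      pose proof (HG (S n) z S1 p) as G1. pose proof (HG (S (S n)) z S1 p) as G2.
      fold c in G1, G2. cbv beta in G1, G2.
      apply Rplus_le_compat.
      * rewrite Rmult_assoc. apply Rmult_le_compat; auto; apply Cmod_ge_0.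
      * rewrite !(Rmult_assoc e). apply Rmult_le_compat; auto; [apply Cmod_ge_0| |].
        -- apply Rmult_le_pos; apply Cmod_ge_0.
        -- apply Rmult_le_compat; auto; apply Cmod_ge_0.
  - assert (H4 : Cmod h * (16 * K + 1) <= eps).
    { apply Rlt_le. replace eps with (eps / (16 * K + 1) * (16 * K + 1)) by (field; lra).
      apply Rmult_lt_compat_r; lra. }
    nra.
Qed.

Lemma strip_open (s : R) (z h : C) :
  Cmod h < s - Rabs (snd z) -> Rabs (snd (z + h)%C) < s.
Proof.
  intros H. pose proof (Rabs_snd_le_Cmod h). simpl.
  eapply Rle_lt_trans; [apply Rabs_triang | lra].
Qed.

(** Off the sector the iterated derivatives are arbitrary, so the induction carries only agreement
    on the sector; since the sector is open, this determines the next derivative there. *)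
Lemma rl_derive_n_borel_sum (gamma B A : R) (wt W : nat -> R) b alpha (f : RLog -> C) :
  admissible_blocks (gamma * PI / 2) B wt W b -> 0 <= A ->
  (forall p, Cmod (alpha p) <= A * wt p) ->
  (forall z, sector gamma z -> f z = borel_sum b alpha 0 z) ->
  forall n z, sector gamma z -> rl_derive_n f n z = borel_sum b alpha n z /\
    is_rl_derive (rl_derive_n f n) z (borel_sum b alpha (S n) z).
Proof.
  intros Hb HA Ha Hf.
  assert (Step : forall n (F : RLog -> C),
    (forall z, sector gamma z -> F z = borel_sum b alpha n z) ->
    forall z, sector gamma z -> is_rl_derive F z (borel_sum b alpha (S n) z)).
  { intros n F HF z Hz. unfold sector, rl_arg in *.
    apply (is_rl_derive_cderive F (borel_sum b alpha n) z _ (gamma * PI / 2 - Rabs (snd z))).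
    - lra.
    - intros h Hh. apply HF. exact (strip_open _ z h Hh).
    - eapply is_cderive_borel_sum; eauto. }
  assert (H : forall n z, sector gamma z -> rl_derive_n f n z = borel_sum b alpha n z).
  { induction n as [|n IH]; intros z Hz; simpl; [auto|].
    apply rl_derive_unique, Step; auto. }
  intros n z Hz. split; auto.
Qed.

Lemma exists_admissible_blocks (omega : R -> R) (gamma l : R) :
  W0 omega -> 0 < gamma -> Rbar_lt gamma (Rbar_minus (growth_index omega) 1) -> 0 < l ->
  exists (d : nat) (B : R) (b : nat -> nat -> C -> C), (0 < d)%nat /\ 0 < B /\
    admissible_blocks (gamma * PI / 2) B (weight omega l) (weight omega (INR d * l)) b.
Proof.
  intros HW Hg Hidx Hl.
  destruct (exists_blocks omega gamma l HW Hg Hidx Hl) as [a [V [N [d [B [Hd [HB H]]]]]]].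
  exists d, B, (fun p => block a (V p) p (N p)). split; [exact Hd|]. split; [exact HB|].
  split; [|split].
  - intros p. apply block_remainder_chain.
  - intros p n w Hw. specialize (H p n n w (le_n n) Hw).
    rewrite block_remainder_diag, Rminus_diag, Rmult_0_l, exp_0, Rmult_1_r in H. exact H.
  - intros p n w Hw. specialize (H p n (S n) w (le_S _ _ (le_n n)) Hw).
    rewrite block_remainder_succ in H. rewrite S_INR in H.
    replace ((INR n + 1 - INR n) * fst w) with (fst w) in H by ring. exact H.
Qed.

(** * The extension operator and its norm bound *)

Lemma in_Lambda_bound (omega : R -> R) (l : R) (alpha : nat -> C) (M : R) :
  Rbar_le (Lambda_norm omega l alpha) M ->
  forall p, Cmod (alpha p) <= M * weight omega l p.
Proof.
  intros H p. unfold Lambda_norm in H.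
  match type of H with Rbar_le (Lub_Rbar ?E) _ =>
    destruct (Lub_Rbar_correct E) as [HU _] end.
  specialize (HU _ (ex_intro _ p eq_refl)).
  pose proof (Rbar_le_trans _ _ _ HU H) as K. simpl in K.
  pose proof (weight_pos omega l p) as P.
  apply Rmult_le_compat_r with (r := weight omega l p) in K; [|lra].
  unfold Rdiv in K. rewrite Rmult_assoc, Rinv_l, Rmult_1_r in K by lra. exact K.
Qed.

Lemma in_Lambda_exists_bound (omega : R -> R) (l : R) (alpha : nat -> C) :
  in_Lambda omega l alpha ->
  exists A, 0 <= A /\ forall p, Cmod (alpha p) <= A * weight omega l p.
Proof.
  intros H. unfold in_Lambda in H.
  destruct (Lambda_norm omega l alpha) as [M| |] eqn:E; try contradiction.
  - exists (Rmax 0 M). split; [apply Rmax_l|]. apply in_Lambda_bound.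
    rewrite E. apply Rmax_r.
  - exists 0. split; [lra|]. apply in_Lambda_bound. rewrite E. exact I.
Qed.

Lemma A_norm_borel_sum_le (omega : R -> R) (l m gamma B A : R) b alpha (f : RLog -> C) :
  admissible_blocks (gamma * PI / 2) B (weight omega l) (weight omega m) b -> 0 <= A ->
  (forall p, Cmod (alpha p) <= A * weight omega l p) ->
  (forall z, sector gamma z -> f z = borel_sum b alpha 0 z) ->
  Rbar_le (A_norm omega m (sector gamma) f) (4 * (A * B)).
Proof.
  intros Hb HA Ha Hf. unfold A_norm.
  match goal with |- Rbar_le (Lub_Rbar ?E) _ =>
    destruct (Lub_Rbar_correct E) as [_ HL] end.
  apply HL. intros v [z [p [Hz ->]]]. simpl.
  destruct (rl_derive_n_borel_sum _ _ _ _ _ _ _ f Hb HA Ha Hf p z Hz) as [-> _].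
  pose proof (weight_pos omega m p) as P.
  apply Rmult_le_reg_r with (weight omega m p); [exact P|].
  unfold Rdiv. rewrite Rmult_assoc, Rinv_l, Rmult_1_r by lra.
  replace (4 * (A * B) * weight omega m p) with (4 * (A * (B * weight omega m p))) by ring.
  eapply Cmod_borel_sum_le; eauto. left. exact Hz.
Qed.

Theorem theorem6p8 (omega : R -> R) (Homega : W0 omega)
    (Hgamma : Rbar_lt 1 (growth_index omega)) :
  (forall gamma : R, 0 < gamma ->
     Rbar_lt gamma (Rbar_minus (growth_index omega) 1) ->
     forall l : R, 0 < l ->
     exists d : nat, (0 < d)%nat /\
     exists E : (nat -> C) -> RLog -> C,
       maps_into omega l (INR d * l) (sector gamma) E /\
       linear_operator omega l (sector gamma) E /\
       continuous_operator omega l (INR d * l) (sector gamma) E /\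
       extension_operator omega l (sector gamma) E) /\
  (forall gamma : R, 0 < gamma ->
     Rbar_lt gamma (Rbar_minus (growth_index omega) 1) ->
     forall a : nat -> C, in_Lambda_union omega a ->
     exists f : RLog -> C,
       in_A_union omega (sector gamma) f /\ is_borel (sector gamma) f a).
Proof.
  assert (Main : forall gamma : R, 0 < gamma ->
     Rbar_lt gamma (Rbar_minus (growth_index omega) 1) ->
     forall l : R, 0 < l ->
     exists d : nat, (0 < d)%nat /\
     exists E : (nat -> C) -> RLog -> C,
       maps_into omega l (INR d * l) (sector gamma) E /\
       linear_operator omega l (sector gamma) E /\
       continuous_operator omega l (INR d * l) (sector gamma) E /\
       extension_operator omega l (sector gamma) E).
  { intros gamma Hg Hidx l Hl.
    destruct (exists_admissible_blocks omega gamma l Homega Hg Hidx Hl)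
      as [d [B [b [Hd [PB Hb]]]]].
    exists d. split; [exact Hd|]. exists (fun alpha z => borel_sum b alpha 0 z).
    assert (Hstrip : forall z, sector gamma z -> Rabs (snd z) <= gamma * PI / 2).
    { intros z Hz. left. exact Hz. }
    split; [|split; [split|split]].
    - intros alpha Halpha.
      destruct (in_Lambda_exists_bound _ _ _ Halpha) as [A [PA HA]]. split.
      + intros z Hz. eexists.
        exact (proj2 (rl_derive_n_borel_sum _ _ _ _ _ _ _ _ Hb PA HA
          (fun _ _ => eq_refl) O z Hz)).
      + eapply Rbar_le_lt_trans; [|exact (I : Rbar_lt (4 * (A * B)) p_infty)].
        apply (A_norm_borel_sum_le omega l _ gamma B A b alpha); auto.
    - intros alpha beta Halpha Hbeta z Hz.
      destruct (in_Lambda_exists_bound _ _ _ Halpha) as [A [PA HA]].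
      destruct (in_Lambda_exists_bound _ _ _ Hbeta) as [A' [PA' HA']].
      pose proof (borel_sum_lin _ _ _ _ _ _ _ 1%C alpha beta O z Hb PA PA' HA HA'
        (Hstrip z Hz)) as E.
      rewrite Cmult_1_l in E. rewrite <- E. apply CSeries_ext. intros p. unfold Cdiv. ring.
    - intros c alpha Halpha z Hz.
      destruct (in_Lambda_exists_bound _ _ _ Halpha) as [A [PA HA]].
      (* Scaling is the case (c - 1) alpha + alpha of the combination treated by [borel_sum_lin]. *)
      pose proof (borel_sum_lin _ _ _ _ _ _ _ (c - 1)%C alpha alpha O z Hb PA PA HA HA
        (Hstrip z Hz)) as E.
      replace (c * borel_sum b alpha 0 z)%C with
        ((c - 1) * borel_sum b alpha 0 z + borel_sum b alpha 0 z)%C by ring.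
      rewrite <- E. apply CSeries_ext. intros p. unfold Cdiv. ring.
    - intros alpha Halpha eps.
      destruct (in_Lambda_exists_bound _ _ _ Halpha) as [A [PA HA]].
      (* By linearity the difference of the images is the image of beta - alpha, of norm at most 4 B
         delta < eps. *)
      assert (Pd : 0 < eps / (4 * B + 1)).
      { apply Rdiv_lt_0_compat; [apply cond_pos | lra]. }
      exists (mkposreal _ Pd). intros beta Hbeta Hdist. simpl in Hdist.
      destruct (in_Lambda_exists_bound _ _ _ Hbeta) as [A' [PA' HA']].
      pose proof (in_Lambda_bound _ _ _ _ (Rbar_lt_le _ _ Hdist)) as HD.
      eapply Rbar_le_lt_trans.
      + apply (A_norm_borel_sum_le omega l _ gamma B _ b _ _ Hb (Rlt_le _ _ Pd) HD).
        intros z Hz.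
        pose proof (borel_sum_lin _ _ _ _ _ _ _ (-1)%C alpha beta O z Hb PA PA' HA HA'
          (Hstrip z Hz)) as E.
        replace (borel_sum b beta 0 z - borel_sum b alpha 0 z)%C with
          (-1 * borel_sum b alpha 0 z + borel_sum b beta 0 z)%C by ring.
        rewrite <- E. apply CSeries_ext. intros p. unfold Cdiv. ring.
      + simpl. pose proof (cond_pos eps).
        apply Rmult_lt_reg_r with (4 * B + 1); [lra|].
        replace (4 * (eps / (4 * B + 1) * B) * (4 * B + 1)) with (eps * (4 * B))
          by (field; lra). nra.
    - intros alpha Halpha n.
      destruct (in_Lambda_exists_bound _ _ _ Halpha) as [A [PA HA]].
      (* [K] is the constant of [borel_sum_limit]: the n-th derivative differs from alpha_n by at
         most K |z|. *)
      set (K := 4 * (A * (B * weight omega (INR d * l) (S n)))).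
      assert (PK : 0 <= K).
      { pose proof (weight_pos omega (INR d * l) (S n)). unfold K.
        repeat apply Rmult_le_pos; lra. }
      intros P [eps HP].
      assert (Pd : 0 < eps / (K + 1)).
      { apply Rdiv_lt_0_compat; [apply cond_pos | lra]. }
      exists (mkposreal _ Pd). intros z Hz1 Hz. simpl in Hz1. apply HP.
      destruct (rl_derive_n_borel_sum _ _ _ _ _ _ _ (fun z => borel_sum b alpha 0 z)
        Hb PA HA (fun _ _ => eq_refl) n z Hz) as [Ez _].
      refine (eq_ind_r (fun x => ball (alpha n) eps x) _ Ez).
      pose proof (borel_sum_limit _ _ _ _ _ _ alpha n z Hb PA HA (Hstrip z Hz)) as HL.
      assert (HQ : Cmod (borel_sum b alpha n z - alpha n)%C < eps).
      { eapply Rle_lt_trans; [exact HL|]. unfold rl_mod in Hz1.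
        change (exp (@fst R R z)) with (exp (fst z)) in HL |- *.
        replace (4 * (A * (B * weight omega (INR d * l) (S n) * exp (fst z))))
          with (K * exp (fst z)) by (unfold K; ring).
        pose proof (exp_pos (fst z)).
        apply Rle_lt_trans with ((K + 1) * exp (fst z)); [nra|].
        apply Rmult_lt_compat_l with (r := K + 1) in Hz1; [|lra].
        replace ((K + 1) * (eps / (K + 1))) with (pos eps) in Hz1 by (field; lra).
        exact Hz1. }
      split.
      + eapply Rle_lt_trans; [|exact HQ]. eapply Rle_trans; [|apply Rabs_fst_le_Cmod].
        apply Req_le. reflexivity.
      + eapply Rle_lt_trans; [|exact HQ]. eapply Rle_trans; [|apply Rabs_snd_le_Cmod].
        apply Req_le. reflexivity. }
  split; [exact Main|].
  (* Each sequence of the union lies in a space of some index l, and the operator for that l extends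
     it. *)
  intros gamma Hg Hidx a [l [Hl Ha]].
  destruct (Main gamma Hg Hidx l Hl) as [d [Hd [E [HE1 [_ [_ HE2]]]]]].
  exists (E a). split; [|apply HE2, Ha].
  exists (INR d * l). split; [|apply HE1, Ha].
  apply Rmult_lt_0_compat; [apply lt_0_INR; exact Hd | exact Hl].
Qed.
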